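(* Let $\Sigma\subseteq\mathbb{F}_n^+$ be an admissible set and let $M:\Sigma\to\mathcal{H}$ be a map with values in a Hilbert space $\mathcal{H}$. Then there is a Poisson transform $\mu:C^*(S_1,\ldots,S_n)\to B(\mathcal{H})$ such that $$M(p(g_1,\ldots,g_n))=\mu(p(S_1,\ldots,S_n))\,M(g_0)$$ for every polynomial $p(g_1,\ldots,g_n)\in\mathbb{C}\Sigma$ (i.e. $M$ is a vector-valued moment map for Poisson transforms on $C^*(S_1,\ldots,S_n)$) if and only if $K_3\le K_4$, where $K_3,K_4:\Lambda_\Sigma\times\Lambda_\Sigma\to\mathbb{C}$ are the kernels $$K_3((\alpha,\beta),(\sigma,\gamma)):=\langle M(\sigma\gamma),M(\alpha\beta)\rangle,$$ $$K_4((\alpha,\beta),(\sigma,\gamma)):=\begin{cases}\langle M((\sigma\backslash\alpha)\gamma),M(\beta)\rangle, & \alpha\le\sigma\\ \langle M(\gamma),M((\alpha\backslash\sigma)\beta)\rangle, & \sigma<\alpha\\ 0, & \text{otherwise.}\end{cases}$$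
   Context: Let $n\in\{1,2,\ldots\}$ or $n=\infty$. $\mathbb{F}_n^+$ is the free semigroup with generators $g_1,\ldots,g_n$ and neutral element $g_0$. Let $H_n$ be an $n$-dimensional complex Hilbert space with orthonormal basis $e_1,\ldots,e_n$, and $F^2(H_n)=\bigoplus_{k\ge0}H_n^{\otimes k}$ (with $H_n^{\otimes 0}=\mathbb{C}1$) the full Fock space. The left creation operators are $S_i\psi=e_i\otimes\psi$, $\psi\in F^2(H_n)$. $C^*(S_1,\ldots,S_n)$ is the $C^*$-algebra generated by $S_1,\ldots,S_n$, and $\mathcal{A}_n$ is the norm-closed (non-selfadjoint) algebra generated by $S_1,\ldots,S_n$ and the identity. For operators $T_1,\ldots,T_n$, $T_\alpha:=T_{i_1}\cdots T_{i_k}$ if $\alpha=g_{i_1}\cdots g_{i_k}$, and $T_{g_0}:=I$. A Poisson transform on $C^*(S_1,\ldots,S_n)$ is a unital completely positive linear map $\mu:C^*(S_1,\ldots,S_n)\to B(\mathcal{H})$ such that $\mu(AX)=\mu(A)\mu(X)$ for all $A\in\mathcal{A}_n$ and $X\in\mathcal{A}_n\mathcal{A}_n^*$. A set $\Sigma\subseteq\mathbb{F}_n^+$ is admissible if $\alpha\beta\in\Sigma$ implies $\beta\in\Sigma$ (so a nonempty admissible set contains $g_0$). $\mathbb{C}\Sigma$ is the set of finite sums $p=\sum_{\sigma\in\Sigma}a_\sigma\sigma$, $a_\sigma\in\mathbb{C}$; for such $p=p(g_1,\ldots,g_n)$ one puts $p(S_1,\ldots,S_n)=\sum a_\sigma S_\sigma$,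 and $M$ is extended linearly, $M(p)=\sum a_\sigma M(\sigma)$. $\Lambda_\Sigma:=\{(\alpha,\beta):\alpha,\beta\in\mathbb{F}_n^+,\ \alpha\beta\in\Sigma\}$. For $\sigma,\alpha\in\mathbb{F}_n^+$, $\sigma\le\alpha$ means $\alpha=\sigma\tau$ for some $\tau\in\mathbb{F}_n^+$; then $\alpha\backslash\sigma:=\tau$; $\sigma<\alpha$ means moreover $\tau\ne g_0$. Inner products are linear in the first variable. A kernel $K:X\times X\to\mathbb{C}$ on a set $X$ is positive semidefinite if $\sum_{x,y\in X}K(x,y)h(y)\overline{h(x)}\ge0$ for all finitely supported $h:X\to\mathbb{C}$; $K_3\le K_4$ means that $K_4-K_3$ is positive semidefinite. *)

(* Defs.v *)
From HB Require Import structures.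
From mathcomp Require Import all_boot all_order all_algebra finmap.
From mathcomp Require Import sesquilinear complex.
From mathcomp Require Import all_classical all_reals all_analysis.
From mathcomp Require Import ring lra.
From mathcomp.analysis.showcase Require summability.
Set Implicit Arguments.
Unset Strict Implicit.
Unset Printing Implicit Defensive.
Import Order.TTheory GRing.Theory Num.Theory.
Import numFieldNormedType.Exports.
Local Open Scope classical_set_scope.
Local Open Scope ring_scope.

#[local] Existing Instance summability.totally_filter.

Section DotProduct.
Variables (C : numClosedFieldType) (U : lmodType C) (form : {dot U for (@Num.conj C)}).
Local Notation "''[' u , v ]" := (form u v) : ring_scope.
Local Notation "''[' u ]" := '[u, u]%R : ring_scope.

Lemma dot_CauchySchwarz u v : `|'[u, v]| ^+ 2 <= '[u] * '[v].
Proof.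
have [-> | nz_v] /= := altP (v =P 0).
  by rewrite !linear0r normr0 expr0n.
pose a := '[u, v] / '[v]; pose u1 := u - a *: v.
have ou: '[u1, v] = 0.
    rewrite linearBl/=.
    rewrite linearZl_LR.
    by rewrite divfK ?dnorm_eq0 ?subrr.
rewrite (canRL (subrK _) (erefl u1)).
  rewrite linearDl /= ou add0r.
  rewrite linearZl_LR/= normrM (ger0_norm (dnorm_ge0 _ _)).
  rewrite exprMn (exprS '[v] 1) expr1 mulrA ler_pM2r ?dnorm_gt0 //.
  rewrite -dnormZ hnormDd/=; last by rewrite linearZr_LR/= ou mulr0.
  by rewrite lerDr dnorm_ge0.
Qed.

Lemma dot_triangle u v :
  sqrtC '[u + v] <= sqrtC '[u] + sqrtC '[v].
Proof.
rewrite -ler_sqr ?rpredD ?nnegrE ?sqrtC_ge0 ?dnorm_ge0 ?addr_ge0 ?sqrtC_ge0 ?dnorm_ge0//.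
rewrite sqrrD !sqrtCK addrAC dnormD (lerD2l _)/=.
rewrite -sqrtCM ?nnegrE ?dnorm_ge0 // -mulr_natr -[_ + _](divfK (negbT (pnatr_eq0 C 2))) ler_pM2r ?ltr0n //.
rewrite -ReE; have [h _] := leif_Re_Creal '[u, v]; apply: le_trans h _.
have g0 : 0 <= '[u] * '[v] by rewrite mulr_ge0 ?dnorm_ge0.
have := dot_CauchySchwarz u v.
by rewrite -[X in _ <= X -> _]sqrtCK ler_sqr ?nnegrE ?sqrtC_ge0.
Qed.

End DotProduct.

(* Complex Hilbert spaces: complete normed spaces whose norm comes from an inner
   product, linear in the first variable. *)
HB.mixin Record isHilbert (R : realType) H & CompleteNormedModule R[i] H := {
  inner : {dot H for (@Num.conj R[i])} ;
  inner_norm : forall x : H, inner x x = `|x| ^+ 2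
}.
#[short(type="hilbertType")]
HB.structure Definition Hilbert (R : realType) :=
  {H of CompleteNormedModule R[i] H & isHilbert R H}.

Section UnconditionalSums.
Context {K : numFieldType} {V : normedModType K} {I : choiceType}.
Implicit Types (u v : I -> V) (s t : V).

Definition has_sum u s := summability.partial_sum u @ summability.totally --> s.

Lemma has_sum_lim u s : has_sum u s -> summability.sum u = s.
Proof. exact: cvg_lim. Qed.

Lemma has_sumD u v s t :
  has_sum u s -> has_sum v t -> has_sum (fun x => u x + v x) (s + t).
Proof.
move=> us vt; rewrite /has_sum.
suff -> : summability.partial_sum (fun x => u x + v x) =
  (fun A => summability.partial_sum u A + summability.partial_sum v A) by exact: cvgD.
by apply/funext => A; rewrite /summability.partial_sum big_split.
Qed.

Lemma has_sumZ a u s : has_sum u s -> has_sum (fun x => a *: u x) (a *: s).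
Proof.
move=> us; rewrite /has_sum.
suff -> : summability.partial_sum (fun x => a *: u x) =
  (fun A => a *: summability.partial_sum u A) by exact: cvgZr.
by apply/funext => A; rewrite /summability.partial_sum scaler_sumr.
Qed.

End UnconditionalSums.

Section Sums.
Context {R : realType} {I : choiceType}.
Implicit Types (f g u v : I -> R[i]) (A B : {fset I}).

(* Unconditional sum: the limit of the partial sums along the directed set of
   finite subsets of I. *)
Definition csum u : R[i] := summability.sum (u : I -> R[i]^o).

Local Notation hsum u s := (has_sum (u : I -> R[i]^o) (s : R[i]^o)).

Definition square_summable f :=
  exists M : R[i], forall A : {fset I}, \sum_(x <- A) `|f x| ^+ 2 <= M.

Local Notation psum u := (summability.partial_sum (u : I -> R[i]^o)).

Let psumE u A : psum u A = \sum_(x <- A) u x.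
Proof. by rewrite /summability.partial_sum big_seq_fsetE. Qed.

Lemma sum_fset_le u A B : (forall x, 0 <= u x) -> (A `<=` B)%fset ->
  \sum_(x <- A) u x <= \sum_(x <- B) u x.
Proof.
move=> u0 AB; pose F x := if x \in A then u x else 0.
have -> : \sum_(x <- A) u x = \sum_(x <- A) F x.
  by rewrite big_seq [RHS]big_seq; apply: eq_bigr => x xA; rewrite /F xA.
rewrite (big_fset_incl _ AB) /F; last by move=> x _ /negbTE ->.
by apply: ler_sum => x _; case: ifP.
Qed.

Lemma cvg_sum_ge0 u (M : R[i]) : (forall x, 0 <= u x) ->
  (forall A, \sum_(x <- A) u x <= M) ->
  exists s : R[i], [/\ hsum u s,
    s <= M & forall A, \sum_(x <- A) u x <= s].
Proof.
move=> u0 uM; pose P := [set complex.Re (\sum_(x <- A) u x) | A in [set: {fset I}]].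
have sE A : \sum_(x <- A) u x = (complex.Re (\sum_(x <- A) u x))%:C%C.
  by rewrite RRe_real // ger0_real // sumr_ge0.
have M0 : 0 <= M by have := uM fset0; rewrite big_seq_fset0.
have ME : M = (complex.Re M)%:C%C by rewrite RRe_real // ger0_real.
have PM : ubound P (complex.Re M).
  by move=> _ [A _ <-]; have := uM A; rewrite sE ME lecR.
have hP : has_sup P.
  by split; [exists (complex.Re (\sum_(x <- fset0) u x)), fset0|exists (complex.Re M)].
exists ((sup P)%:C)%C; split.
- apply/cvgrPdist_le => e e0.
  have eE : e = (complex.Re e)%:C%C by rewrite RRe_real // gtr0_real.
  have e0' : 0 < complex.Re e by rewrite -(ltcR 0) -eE.
  have [_ [A _ <-] Ae] := sup_adherent e0' hP.
  exists A => // B /= AB; rewrite psumE.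
  have h1 := sum_fset_le u0 AB.
  have h2 : \sum_(x <- B) u x <= ((sup P)%:C)%C.
    by rewrite sE lecR; apply: ub_le_sup; [case: hP|exists B].
  rewrite ger0_norm ?subr_ge0 // lerBlDr -lerBlDl; apply: le_trans h1.
  by rewrite eE (sE A) -rmorphB lecR ltW.
- by rewrite ME lecR; apply: ge_sup => //; case: hP.
- by move=> A; rewrite sE lecR; apply: ub_le_sup; [case: hP|exists A].
Qed.

Lemma cvg_csum u v (M : R[i]) : (forall x, `|u x| <= v x) ->
  (forall A, \sum_(x <- A) v x <= M) ->
  hsum u (csum u).
Proof.
move=> uv vM.
have v0 x : 0 <= v x by apply: le_trans (uv x).
have real_case w : (forall x, w x \is Num.real) -> (forall x, `|w x| <= v x) ->
    exists s : R[i], hsum w s.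
  move=> wr wv.
  have [s1 [c1 _ _]] := @cvg_sum_ge0 v M v0 vM.
  have [|A|s2 [c2 _ _]] := @cvg_sum_ge0 (fun x => w x + v x) (M + M).
  - by move=> x; rewrite -lerBlDr sub0r; have := wv x; rewrite real_ler_norml // => /andP[].
  - rewrite big_split lerD //= (le_trans _ (vM A)) // ler_sum // => x _.
    by have := wv x; rewrite real_ler_norml // => /andP[].
  exists (s2 + -1 *: s1).
  have := has_sumD c2 (has_sumZ (a := -1) c1).
  by congr has_sum; apply/funext => x; rewrite scaleN1r addrK.
have [s1 c1] : exists s : R[i], hsum (fun x => 'Re (u x)) s.
  apply: real_case => x; first exact: Creal_Re.
  by apply: le_trans (uv x); have [] := leif_normC_Re_Creal (u x).
have [s2 c2] : exists s : R[i], hsum (fun x => 'Im (u x)) s.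
  apply: real_case => x; first exact: Creal_Im.
  apply: le_trans (uv x).
  by have [] := leif_normC_Re_Creal ('i * u x); rewrite ReMil normrN normrM normCi mul1r.
have := has_sumD c1 (has_sumZ (a := 'i) c2).
set s := (X in has_sum _ X); rewrite (_ : (fun x => _) = u) => [h|].
  by rewrite /csum (has_sum_lim h).
by apply/funext => x; rewrite [RHS]Crect.
Qed.

Lemma square_summable_submod : submod_closed [pred f | `[< square_summable f >]].
Proof.
split=> [|a f g /asboolP[M fM] /asboolP[N gN]]; apply/asboolP.
  by exists 0 => A; rewrite big1 // => x _; rewrite normr0 expr0n.
exists (2 * (`|a| ^+ 2 * M + N)) => A.
apply: (@le_trans _ _ (\sum_(x <- A) 2 * (`|a| ^+ 2 * `|f x| ^+ 2 + `|g x| ^+ 2))).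
  apply: ler_sum => x _; rewrite -exprMn -normrM.
  change ((a *: f + g) x) with (a * f x + g x).
  set s := a * f x; apply: (@le_trans _ _ ((`|s| + `|g x|) ^+ 2)).
    by rewrite ler_sqr ?nnegrE ?addr_ge0 // ler_normD.
  rewrite -subr_ge0 (_ : _ - _ = (`|s| - `|g x|) ^+ 2); last by ring.
  by rewrite real_exprn_even_ge0 // rpredB // ?realE ?normr_ge0.
rewrite -mulr_sumr ler_pM2l // big_split /= -mulr_sumr lerD // ler_wpM2l // exprn_ge0 //.
Qed.

End Sums.

(* The Hilbert space of square-summable families indexed by I. *)
Definition ell2_pred (R : realType) (I : choiceType) : {pred I -> R[i]} :=
  [pred f | `[< square_summable f >]].
Arguments ell2_pred : clear implicits.

HB.instance Definition _ (R : realType) (I : choiceType) :=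
  GRing.isSubmodClosed.Build R[i] (I -> R[i]) (ell2_pred R I)
    (square_summable_submod (R := R) (I := I)).

Record ell2 (R : realType) (I : choiceType) :=
  Ell2 { ell2_fun :> I -> R[i]; _ : ell2_fun \in ell2_pred R I }.

HB.instance Definition _ (R : realType) (I : choiceType) :=
  [isSub for @ell2_fun R I].
HB.instance Definition _ (R : realType) (I : choiceType) :=
  [Choice of ell2 R I by <:].
HB.instance Definition _ (R : realType) (I : choiceType) :=
  [SubChoice_isSubLmodule of ell2 R I by <:].

Section Ell2.
Context {R : realType} {I : choiceType}.
Implicit Types (f g h : ell2 R I) (a : R[i]) (A : {fset I}).

Lemma ell2P f g : (forall x, f x = g x) -> f = g.
Proof. by move=> fg; apply/val_inj/funext. Qed.

Lemma ell2DE f g x : (f + g) x = f x + g x. Proof. by []. Qed.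
Lemma ell2ZE a f x : (a *: f) x = a * f x. Proof. by []. Qed.
Lemma ell2NE f x : (- f) x = - f x. Proof. by []. Qed.
Lemma ell20E x : (0 : ell2 R I) x = 0. Proof. by []. Qed.

Lemma ell2_summable f : square_summable f.
Proof. by case: f => f /= /asboolP. Qed.

Definition ell2_inner f g : R[i] := csum (fun x => f x * (g x)^*).

Lemma ell2_inner_sum f g :
  has_sum (fun x => f x * (g x)^* : R[i]^o) (ell2_inner f g : R[i]^o).
Proof.
have [[M fM] [N gN]] := (ell2_summable f, ell2_summable g).
apply: (@cvg_csum _ _ _ (fun x => `|f x| ^+ 2 + `|g x| ^+ 2) (M + N)) => [x|A].
  rewrite normrM norm_conjC.
  have [fg|fg] := real_leP (normr_real (f x)) (normr_real (g x)).
    by apply: (@le_trans _ _ (`|g x| ^+ 2)); rewrite ?lerDr ?exprn_ge0 // expr2 ler_wpM2r.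
  by apply: (@le_trans _ _ (`|f x| ^+ 2)); rewrite ?lerDl ?exprn_ge0 // expr2 ler_wpM2l // ltW.
by rewrite big_split lerD.
Qed.

Arguments ell2_inner_sum : clear implicits.

Lemma ell2_inner_linearl g : GRing.linear_for *%R (ell2_inner ^~ g).
Proof.
move=> a f1 f2 /=; have := has_sumD (has_sumZ (a := a) (ell2_inner_sum f1 g)) (ell2_inner_sum f2 g).
rewrite [X in has_sum X _](_ : _ = (fun x => (a *: f1 + f2) x * (g x)^* : R[i]^o)).
  exact: has_sum_lim.
by apply/funext => x; rewrite ell2DE ell2ZE mulrDl -mulrA.
Qed.

Lemma ell2_inner_herm f g : ell2_inner f g = (ell2_inner g f)^*.
Proof.
apply: (has_sum_lim (V := R[i]^o)); apply/cvgrPdist_le => e e0.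
have /cvgrPdist_le /(_ e e0) := ell2_inner_sum g f.
apply: filterS => A; rewrite /= -norm_conjC rmorphB /=; congr (`|_ - _| <= _).
rewrite /summability.partial_sum rmorph_sum.
by apply: eq_bigr => x _; rewrite rmorphM /= conjCK mulrC.
Qed.

Lemma ell2_inner_linearr f : GRing.linear_for (Num.conj \; *%R) (ell2_inner f).
Proof.
move=> a g1 g2 /=.
by rewrite !(ell2_inner_herm f) ell2_inner_linearl rmorphD rmorphM.
Qed.

Lemma ell2_sum_le f A : \sum_(x <- A) `|f x| ^+ 2 <= ell2_inner f f.
Proof.
have [M fM] := ell2_summable f.
have [s [c _ sA]] := @cvg_sum_ge0 R I (fun x => `|f x| ^+ 2) M
  (fun x => exprn_ge0 2 (normr_ge0 _)) fM.
suff -> : ell2_inner f f = s by [].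
apply: (has_sum_lim (V := R[i]^o)); move: c; congr has_sum.
by apply/funext => x; rewrite normCK.
Qed.

Lemma ell2_inner_le f (M : R[i]) :
  (forall A, \sum_(x <- A) `|f x| ^+ 2 <= M) -> ell2_inner f f <= M.
Proof.
move=> fM.
have [s [c sM _]] := @cvg_sum_ge0 R I (fun x => `|f x| ^+ 2) M
  (fun x => exprn_ge0 2 (normr_ge0 _)) fM.
suff -> : ell2_inner f f = s by [].
apply: (has_sum_lim (V := R[i]^o)); move: c; congr has_sum.
by apply/funext => x; rewrite normCK.
Qed.

Lemma ell2_inner_gt0 f : f != 0 -> 0 < ell2_inner f f.
Proof.
move=> /eqP f0; have [x /eqP fx] : exists x, f x <> 0.
  by apply/existsNP => f0'; apply: f0; apply: ell2P => x; rewrite f0' ell20E.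
apply: (@lt_le_trans _ _ (`|f x| ^+ 2)); first by rewrite exprn_gt0 // normr_gt0.
by have := ell2_sum_le f [fset x]%fset; rewrite big_seq_fset1.
Qed.

HB.instance Definition _ := @bilinear_isBilinear.Build R[i] (ell2 R I) (ell2 R I) R[i]
  _ _ ell2_inner (ell2_inner_linearl, ell2_inner_linearr).

Let ell2_inner_hermitian f g :
  ell2_inner f g = (-1) ^+ false * Num.conj (ell2_inner g f).
Proof. by rewrite expr0 mul1r ell2_inner_herm. Qed.

HB.instance Definition _ := @isHermitianSesquilinear.Build R[i] (ell2 R I) false
  Num.conj ell2_inner ell2_inner_hermitian.

HB.instance Definition _ := @isDotProduct.Build R[i] (ell2 R I) ell2_inner ell2_inner_gt0.

Definition ell2_dot : {dot (ell2 R I) for (@Num.conj R[i])} := ell2_inner.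

Definition ell2_norm f : R[i] := sqrtC (ell2_inner f f).

Lemma ell2_normD f g : ell2_norm (f + g) <= ell2_norm f + ell2_norm g.
Proof. exact: (dot_triangle ell2_dot). Qed.

Lemma ell2_normZ a f : ell2_norm (a *: f) = `|a| * ell2_norm f.
Proof.
rewrite /ell2_norm (dnormZ ell2_dot) sqrtCM ?nnegrE ?exprn_ge0 ?(dnorm_ge0 ell2_dot) //.
by rewrite sqrCK.
Qed.

Lemma ell2_norm_eq0 f : ell2_norm f = 0 -> f = 0.
Proof. by move/eqP; rewrite sqrtC_eq0 (dnorm_eq0 ell2_dot) => /eqP. Qed.

HB.instance Definition _ := @Lmodule_isNormed.Build R[i] (ell2 R I) ell2_norm
  ell2_normD ell2_normZ ell2_norm_eq0.

Lemma ell2_normE f : ell2_inner f f = `|f| ^+ 2.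
Proof. by rewrite sqrtCK. Qed.

End Ell2.

Arguments ell2_inner_sum {R I} f g.

Section Ell2Complete.
Context {R : realType} {I : choiceType}.
Implicit Types (f g h : ell2 R I) (A : {fset I}).

Lemma ell2_coord_le f x : `|f x| <= `|f|.
Proof.
rewrite -ler_sqr ?nnegrE // -ell2_normE.
by have := ell2_sum_le f [fset x]%fset; rewrite big_seq_fset1.
Qed.

Let cvg_lip (F : set_system (ell2 R I)) (FF : ProperFilter F) (phi : ell2 R I -> R) :
  (forall f g, (`|phi f - phi g|)%:C%C <= `|f - g|) -> cauchy F ->
  exists l : R, phi @ F --> l.
Proof.
move=> phiL /cauchyP Fc; apply/cvg_ex; apply: R_complete; apply/cauchyP => e e0.
have [|f Ff] := Fc (e%:C)%C; first by rewrite -(ltcR 0) in e0.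
exists (phi f); rewrite /nbhs /=; apply: filterS Ff => g /=.
rewrite -!ball_normE /= => fg; rewrite -ltcR; exact: le_lt_trans (phiL f g) fg.
Qed.

Lemma ell2_complete (F : set_system (ell2 R I)) :
  ProperFilter F -> cauchy F -> cvg F.
Proof.
move=> FF Fc.
have re x : {l : R | (fun f => complex.Re (f x)) @ F --> l}.
  apply/cid/cvg_lip => // f g; rewrite -raddfB.
  exact: le_trans (normc_ge_Re _) (ell2_coord_le (f - g) x).
have im x : {l : R | (fun f => complex.Im (f x)) @ F --> l}.
  apply/cid/cvg_lip => // f g; rewrite -raddfB; apply: le_trans (ell2_coord_le (f - g) x).
  by rewrite -normrN -ReiNIm; apply: le_trans (normc_ge_Re _) _; rewrite normrM [X in _ * X]normc_def /= expr0n expr1n add0r sqrtr1 mulr1.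
pose u x : R[i] := (sval (re x) +i* sval (im x))%C.
have key f0 (e : R[i]) : 0 < e -> F (ball f0 e) ->
    forall A, \sum_(x <- A) `|u x - f0 x| ^+ 2 <= e ^+ 2.
  move=> e0 Fe A.
  have eE : e ^+ 2 = (complex.Re (e ^+ 2))%:C%C.
    by rewrite RRe_real // gtr0_real // exprn_gt0.
  pose phi (z : R[i]) x := (complex.Re z - complex.Re (f0 x)) ^+ 2 + (complex.Im z - complex.Im (f0 x)) ^+ 2.
  have phiE z x : `|z - f0 x| ^+ 2 = (phi z x)%:C%C by rewrite -add_Re2_Im2 !raddfB.
  under eq_bigr do rewrite phiE.
  rewrite -rmorph_sum eE lecR.
  apply: (cvgr_to_le (F := F) (f := fun f => \sum_(x <- A) phi (f x) x)).
    apply: cvg_big => [|x _]; first exact: add_continuous.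
    have cR := cvgB (svalP (re x)) (cvg_cst (complex.Re (f0 x)) (F := F)).
    have cI := cvgB (svalP (im x)) (cvg_cst (complex.Im (f0 x)) (F := F)).
    exact: cvgD (cvgM (cR _ _) (cR _ _)) (cvgM (cI _ _) (cI _ _)).
  apply: filterS Fe => f; rewrite -ball_normE /= => fe.
  rewrite -lecR -eE rmorph_sum /=; under eq_bigr do rewrite -phiE -normrN opprB.
  apply: le_trans (ell2_sum_le (f0 - f) A) _.
  by rewrite ell2_normE ler_sqr ?nnegrE ?normr_ge0 ?(ltW e0) ?(ltW fe).
have Fex : cauchy_ex F by apply/cauchyP.
have [f1 Ff1] := Fex 1 ltr01.
have us : (fun x => u x - f1 x) \in ell2_pred R I.
  by apply/asboolP; exists (1 ^+ 2); exact: key.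
pose g := Ell2 us + f1.
have gE x : g x = u x by rewrite ell2DE /= subrK.
apply/cvg_ex; exists g; apply/cvgrPdist_le => e e0.
have e20 : 0 < e / 2 by rewrite divr_gt0.
have [f0 Ff0] := Fex _ e20.
apply: filterS (Ff0) => f; rewrite -ball_normE /= => f0f.
rewrite (le_trans (ler_distD f0 _ _)) // [e]splitr lerD ?(ltW f0f) //.
rewrite -ler_sqr ?nnegrE ?(ltW e20) // -ell2_normE; apply: ell2_inner_le => A.
by under eq_bigr do rewrite ell2DE ell2NE gE; exact: key.
Qed.

HB.instance Definition _ := Uniform_isComplete.Build (ell2 R I) ell2_complete.

HB.instance Definition _ := isHilbert.Build R (ell2 R I) (inner := ell2_dot) ell2_normE.

End Ell2Complete.

Definition bounded_op_pred (R : realType) (H : normedModType R[i]) : {pred H -> H} :=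
  [pred f | `[< linear f /\ exists M : R[i], forall x, `|f x| <= M * `|x| >]].
Arguments bounded_op_pred {R} H.

Section BoundedOpSubmod.
Context {R : realType} {H : normedModType R[i]}.

Lemma bounded_op_submod : submod_closed (bounded_op_pred H).
Proof.
split=> [|a f g /asboolP[fl [M fM]] /asboolP[gl [N gN]]]; apply/asboolP; split.
- by move=> a x y; rewrite /= scaler0 addr0.
- by exists 0 => x; rewrite normr0 mul0r.
- move=> b x y; change (a *: f (b *: x + y) + g (b *: x + y) =
    b *: (a *: f x + g x) + (a *: f y + g y)).
  by rewrite fl gl !scalerDr !scalerA (mulrC a) addrACA.
- exists (`|a| * M + N) => x; change (`|a *: f x + g x| <= (`|a| * M + N) * `|x|).
  rewrite mulrDl (le_trans (ler_normD _ _)) // lerD // normrZ -mulrA.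
  by rewrite ler_wpM2l.
Qed.

HB.instance Definition _ :=
  GRing.isSubmodClosed.Build R[i] (H -> H) (bounded_op_pred H) bounded_op_submod.

End BoundedOpSubmod.

Record bounded_op (R : realType) (H : normedModType R[i]) :=
  BoundedOp { bounded_op_fun :> H -> H; _ : bounded_op_fun \in bounded_op_pred H }.
Arguments bounded_op {R} H.

HB.instance Definition _ (R : realType) (H : normedModType R[i]) :=
  [isSub for @bounded_op_fun R H].
HB.instance Definition _ (R : realType) (H : normedModType R[i]) :=
  [Choice of bounded_op H by <:].
HB.instance Definition _ (R : realType) (H : normedModType R[i]) :=
  [SubChoice_isSubLmodule of bounded_op H by <:].

Section BoundedOp.
Context {R : realType} {H : normedModType R[i]}.
Implicit Types (A B : bounded_op H) (a : R[i]) (x y : H).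

Lemma bopP A B : (forall x, A x = B x) -> A = B.
Proof. by move=> AB; apply/val_inj/funext. Qed.

Lemma bopDE A B x : (A + B) x = A x + B x. Proof. by []. Qed.
Lemma bopZE a A x : (a *: A) x = a *: A x. Proof. by []. Qed.
Lemma bopNE A x : (- A) x = - A x. Proof. by []. Qed.
Lemma bop0E x : (0 : bounded_op H) x = 0. Proof. by []. Qed.

Lemma bop_linear A : linear A.
Proof. by case: A => A /= /asboolP[]. Qed.

Lemma bop_bounded A : exists M : R[i], forall x, `|A x| <= M * `|x|.
Proof. by case: A => A /= /asboolP[]. Qed.

HB.instance Definition _ A := GRing.isLinear.Build R[i] H H _ A (bop_linear A).

Lemma bop_id_subproof : id \in bounded_op_pred H.
Proof. by apply/asboolP; split=> //; exists 1 => x; rewrite mul1r. Qed.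
Definition bop_id : bounded_op H := BoundedOp bop_id_subproof.

Lemma bop_comp_subproof A B : A \o B \in bounded_op_pred H.
Proof.
apply/asboolP; split=> [a x y /=|]; first by rewrite !linearP.
have [[M AM] [N BN]] := (bop_bounded A, bop_bounded B).
exists (`|M| * `|N|) => x /=.
have le_norm (c : R[i]) (y : H) (r : R[i]) : 0 <= r -> r <= c * `|y| -> r <= `|c| * `|y|.
  by move=> r0 h; rewrite -(ger0_norm r0) -(normr_id y) -normrM ger0_norm // ger0_norm // (le_trans r0).
apply: le_trans (le_norm _ _ _ (normr_ge0 _) (AM _)) _.
by rewrite -mulrA ler_wpM2l // le_norm.
Qed.
Definition bop_comp A B : bounded_op H := BoundedOp (bop_comp_subproof A B).

Lemma bop_compA : associative bop_comp. Proof. by move=> A B C; exact: bopP. Qed.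
Lemma bop_1comp : left_id bop_id bop_comp. Proof. by move=> A; exact: bopP. Qed.
Lemma bop_comp1 : right_id bop_id bop_comp. Proof. by move=> A; exact: bopP. Qed.
Lemma bop_compDl : left_distributive bop_comp +%R.
Proof. by move=> A B C; exact: bopP. Qed.
Lemma bop_compDr : right_distributive bop_comp +%R.
Proof. by move=> A B C; apply: bopP => x; rewrite bopDE /= linearD. Qed.

HB.instance Definition _ := GRing.Zmodule_isPzRing.Build (bounded_op H)
  bop_compA bop_1comp bop_comp1 bop_compDl bop_compDr.

Lemma bopME A B x : (A * B) x = A (B x). Proof. by []. Qed.
Lemma bop1E x : (1 : bounded_op H) x = x. Proof. by []. Qed.

Definition opnorm A : R[i] :=
  ((sup [set complex.Re `|A x| | x in [set x | `|x| <= 1]])%:C)%C.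

Let normE x : `|x| = (complex.Re `|x|)%:C%C.
Proof. by rewrite RRe_real. Qed.

Lemma opnorm_le A (M : R[i]) : (forall x, `|x| <= 1 -> `|A x| <= M) -> opnorm A <= M.
Proof.
move=> AM; have M0 : 0 <= M by apply: le_trans (AM 0 _); rewrite ?normr0.
rewrite -(RRe_real (ger0_real M0)) lecR; apply: ge_sup.
  by exists (complex.Re `|A 0|), 0 => //=; rewrite normr0.
by move=> _ [x x1 <-]; rewrite -lecR -normE RRe_real ?ger0_real ?AM.
Qed.

Lemma opnorm_ub A x : `|x| <= 1 -> `|A x| <= opnorm A.
Proof.
move=> x1; rewrite normE lecR; apply: ub_le_sup; last by exists x.
have [M AM] := bop_bounded A; exists (complex.Re `|M|) => _ [y /= y1 <-].
rewrite -lecR -!normE; apply: le_trans (AM y) _.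
have h : 0 <= M * `|y| by apply: le_trans (AM y).
by rewrite -(ger0_norm h) normrM normr_id -[leRHS]mulr1 ler_wpM2l.
Qed.

Lemma opnorm_ge0 A : 0 <= opnorm A.
Proof. by apply: le_trans (normr_ge0 (A 0)) (opnorm_ub _ _); rewrite normr0. Qed.

Lemma opnormP A x : `|A x| <= opnorm A * `|x|.
Proof.
have [->|x0] := eqVneq x 0; first by rewrite linear0 normr0 mulr0.
have nx : 0 < `|x| by rewrite normr_gt0.
rewrite -ler_pdivrMr // -[X in X / _]mulr1 mulrC mulr1.
have -> : `|x|^-1 * `|A x| = `|A (`|x|^-1 *: x)|.
  by rewrite linearZ normrZ ger0_norm // invr_ge0.
by apply: opnorm_ub; rewrite normrZ ger0_norm ?invr_ge0 // mulVf // gt_eqF.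
Qed.

Lemma opnormD A B : opnorm (A + B) <= opnorm A + opnorm B.
Proof.
by apply: opnorm_le => x x1; rewrite bopDE (le_trans (ler_normD _ _)) // lerD // opnorm_ub.
Qed.

Let opnormZ_le a A : opnorm (a *: A) <= `|a| * opnorm A.
Proof.
by apply: opnorm_le => x x1; rewrite bopZE normrZ ler_wpM2l // opnorm_ub.
Qed.

Lemma opnormZ a A : opnorm (a *: A) = `|a| * opnorm A.
Proof.
apply/le_anti; rewrite opnormZ_le /=.
have [->|a0] := eqVneq a 0; first by rewrite normr0 mul0r opnorm_ge0.
rewrite mulrC -ler_pdivlMr ?normr_gt0 // mulrC -normfV.
by apply: le_trans (opnormZ_le _ _); rewrite scalerA mulVf // scale1r.
Qed.

Lemma opnorm_eq0 A : opnorm A = 0 -> A = 0.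
Proof.
move=> A0; apply: bopP => x; apply/eqP; rewrite bop0E -normr_le0.
by apply: le_trans (opnormP A x) _; rewrite A0 mul0r.
Qed.

HB.instance Definition _ := @Lmodule_isNormed.Build R[i] (bounded_op H) opnorm
  opnormD opnormZ opnorm_eq0.

End BoundedOp.

Section CountingAids.
Context {R : realType} {I J : choiceType}.

Lemma sum_seq_fset (u : I -> R[i]) (s : seq I) : uniq s ->
  \sum_(x <- s) u x = \sum_(x <- seq_fset tt s) u x.
Proof.
by move=> us; apply/esym/perm_big; rewrite -[X in perm_eq _ X](undup_id us) seq_fset_perm.
Qed.

Lemma partial_sumE {K : choiceType} {V : normedModType R[i]} (u : K -> V) (A : {fset K}) :
  summability.partial_sum u A = \sum_(x <- A) u x.
Proof. by rewrite /summability.partial_sum big_seq_fsetE. Qed.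

Lemma has_sum_reindex (V : normedModType R[i]) (phi : J -> I) (psi : I -> option J)
    (u : I -> V) (s : V) : pcancel phi psi -> ocancel psi phi ->
  (forall k, psi k = None -> u k = 0) ->
  has_sum (fun j => u (phi j)) s -> has_sum u s.
Proof.
move=> phiK psiK u0 /cvgrPdist_le us; apply/cvgrPdist_le => e e0.
have [A _ sA] := us e e0; exists (seq_fset tt (map phi A)) => // B AB.
have upB : uniq (pmap psi B) by rewrite (pmap_uniq psiK).
have := sA (seq_fset tt (pmap psi B)) _; rewrite !partial_sumE.
have -> : \sum_(j <- seq_fset tt (pmap psi B)) u (phi j) = \sum_(k <- B) u k.
  rewrite (perm_big _ (seq_fset_perm _ _)) undup_id //=.
  elim: (enum_fset B) => [|k r IH] /=; first by rewrite !big_nil.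
  rewrite big_cons -IH; case E : (psi k) => [j|] /=; last by rewrite u0 ?add0r.
  by rewrite big_cons; have := psiK k; rewrite E /= => ->.
apply; apply/fsubsetP => j jA; rewrite seq_fsetE mem_pmap -phiK map_f //.
by apply: (fsubsetP AB); rewrite seq_fsetE map_f.
Qed.

End CountingAids.

(* A Hilbert space H with an orthonormal basis indexed by I is ell2 R I; its k-th
   tensor power is then the space of square-summable families indexed by the words
   of length k over I, and the full Fock space, their Hilbert sum over k, is
   ell2 R (seq I): the coordinate at the word i1 :: ... :: ik is that along
   e_i1 (x) ... (x) e_ik (see tensor_basis), the one at [::] is along the vacuum. *)
Section Fock.
Context {R : realType} {I : choiceType}.
Local Notation Fock := (ell2 R (seq I)).
Implicit Types (h : ell2 R I) (psi : Fock).

Lemma ebasis_subproof (i : I) : (fun j : I => (j == i)%:R) \in ell2_pred R I.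
Proof.
apply/asboolP; exists 1 => A.
have [iA|iA] := boolP (i \in A).
  rewrite (big_fsetD1 i) //= eqxx normr1 expr1n big_seq big1 ?addr0 // => j.
  by rewrite !inE => /andP[/negbTE -> _]; rewrite normr0 expr0n.
rewrite big_seq big1 ?ler01 // => j jA; case: eqP => [ji|_]; last by rewrite normr0 expr0n.
by rewrite -ji jA in iA.
Qed.

Definition ebasis (i : I) : ell2 R I := Ell2 (ebasis_subproof i).

Definition tensor_fun h psi (w : seq I) : R[i] :=
  if w is i :: v then h i * psi v else 0.

Lemma tensor_sum_le h psi (A : {fset seq I}) :
  \sum_(w <- A) `|tensor_fun h psi w| ^+ 2 <= `|h| ^+ 2 * `|psi| ^+ 2.
Proof.
pose s1 := undup (flatten [seq take 1 w | w <- A]).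
pose s2 := undup [seq behead w | w <- A].
pose s := [seq i :: v | i <- s1, v <- s2].
have us : uniq s.
  by apply: allpairs_uniq; rewrite ?undup_uniq // => -[i v] [j w] _ _ /= [-> ->].
pose F w := `|tensor_fun h psi w| ^+ 2.
have F0 w : 0 <= F w by rewrite exprn_ge0.
apply: (@le_trans _ _ (\sum_(w <- s) F w)).
  rewrite (bigID (fun w => w == [::])) /= big1 ?add0r; last first.
    by move=> _ /eqP ->; rewrite normr0 expr0n.
  rewrite [leRHS](bigID (mem A)) /= -[leLHS]addr0 lerD ?sumr_ge0 //.
  rewrite -big_filter -[leRHS]big_filter le_eqVlt; apply/orP; left; apply/eqP.
  apply: perm_big; apply: uniq_perm; rewrite ?filter_uniq ?fset_uniq // => w.
  rewrite !mem_filter andbC; have [wA /=|//] := boolP (w \in A).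
  case: w wA => [|i v] wA /=.
    by apply/esym/negbTE/allpairsP => -[[? ?] /= [_ _]].
    apply/esym/allpairsP; exists (i, v) => /=; split => //; rewrite mem_undup.
    by apply/flattenP; exists [:: i]; rewrite ?mem_head //; apply/mapP; exists (i :: v); rewrite /= ?take0.
  by apply/mapP; exists (i :: v); rewrite /= ?take0.
rewrite big_allpairs_dep /F /=.
under eq_bigr do under eq_bigr do rewrite normrM exprMn.
under eq_bigr do rewrite -mulr_sumr.
have le_seq (J : choiceType) (f : ell2 R J) s0 : uniq s0 ->
    \sum_(x <- s0) `|f x| ^+ 2 <= `|f| ^+ 2.
  by move=> us0; rewrite (sum_seq_fset _ us0) -ell2_normE ell2_sum_le.
by rewrite -mulr_suml; apply: ler_pM; rewrite ?le_seq ?undup_uniq // sumr_ge0 // => *;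
  rewrite exprn_ge0.
Qed.

Lemma tensor_subproof h psi : tensor_fun h psi \in ell2_pred R (seq I).
Proof. by apply/asboolP; eexists; exact: tensor_sum_le. Qed.

Definition tensor h psi : Fock := Ell2 (tensor_subproof h psi).

Lemma tensor_norm_le h psi : `|tensor h psi| <= `|h| * `|psi|.
Proof.
rewrite -ler_sqr ?nnegrE ?mulr_ge0 // -ell2_normE exprMn.
exact/ell2_inner_le/tensor_sum_le.
Qed.

Lemma creation_subproof h : tensor h \in bounded_op_pred Fock.
Proof.
apply/asboolP; split; last by exists `|h| => psi; exact: tensor_norm_le.
move=> a psi phi; apply: ell2P => -[|i v]; rewrite ell2DE ell2ZE /=.
  by rewrite mulr0 addr0.
by rewrite mulrDr mulrCA.
Qed.

Definition creation h : bounded_op Fock := BoundedOp (creation_subproof h).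

(* The left creation operator S_i : psi |-> e_i (x) psi. *)
Definition Sop (i : I) : bounded_op Fock := creation (ebasis i).

End Fock.

Section OperatorAlgebras.
Context {R : realType} {H : hilbertType R}.
Implicit Types (A B : bounded_op H) (D : set (bounded_op H)).

Definition adjoint A B := forall x y, inner (A x) y = inner x (B y).

Definition closed_unital_subalgebra D :=
  [/\ closed D, D 1, forall a A B, D A -> D B -> D (a *: A + B)
    & forall A B, D A -> D B -> D (A * B)].

Definition star_closed D := forall A B, adjoint A B -> D A -> D B.

Definition algebra_gen (G : set (bounded_op H)) : set (bounded_op H) :=
  smallest closed_unital_subalgebra G.

Definition cstar_gen (G : set (bounded_op H)) : set (bounded_op H) :=
  smallest (fun D => closed_unital_subalgebra D /\ star_closed D) G.

Lemma cstar_gen1 G : cstar_gen G 1.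
Proof. by move=> D [[[]]]. Qed.

Lemma cstar_gen_submod G : submod_closed [pred A | `[< cstar_gen G A >]].
Proof.
split=> [|a A B /asboolP GA /asboolP GB]; apply/asboolP.
  move=> D DP; rewrite -(subrr 1) -scaleN1r addrC.
  by have [[[_ D1 DD _] _] _] := DP; apply: DD.
move=> D DP; have [[[_ _ DD _] _] _] := DP.
by apply: DD; [exact: GA|exact: GB].
Qed.

Lemma cstar_gen_mul G : mulr_closed [pred A | `[< cstar_gen G A >]].
Proof.
split=> [|A B /asboolP GA /asboolP GB]; apply/asboolP; first exact: cstar_gen1.
by move=> D DP; have [[[_ _ _ DM] _] _] := DP; apply: DM; [exact: GA|exact: GB].
Qed.

End OperatorAlgebras.

Section BackwardShift.
Context {R : realType} {I : choiceType}.
Local Notation Fock := (ell2 R (seq I)).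
Implicit Types (psi phi : Fock).

Lemma tensor_basis (i : I) (w : seq I) :
  tensor (ebasis i) (ebasis w) = ebasis (i :: w) :> Fock.
Proof.
apply: ell2P => -[|j v] //=.
by rewrite eqseq_cons; case: eqP => _ /=; rewrite ?mul1r ?mul0r.
Qed.

Lemma backward_sum_le (i : I) psi (A : {fset seq I}) :
  \sum_(w <- A) `|psi (i :: w)| ^+ 2 <= `|psi| ^+ 2.
Proof.
rewrite -(big_map (cons i) xpredT (fun w => `|psi w| ^+ 2)) -ell2_normE.
have u : uniq [seq i :: w | w <- A] by rewrite map_inj_uniq ?fset_uniq // => ? ? [].
by rewrite (sum_seq_fset _ u) ell2_sum_le.
Qed.

Lemma backward_subproof i psi : (fun w => psi (i :: w)) \in ell2_pred R (seq I).
Proof. by apply/asboolP; eexists; exact: backward_sum_le. Qed.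

Definition backward_fun i psi : Fock := Ell2 (backward_subproof i psi).

Lemma backward_bounded i : backward_fun i \in bounded_op_pred Fock.
Proof.
apply/asboolP; split=> [a psi phi|]; first exact: ell2P.
exists 1 => psi; rewrite mul1r -ler_sqr ?nnegrE // -ell2_normE.
exact/ell2_inner_le/backward_sum_le.
Qed.

Definition backward i : bounded_op Fock := BoundedOp (backward_bounded i).

Lemma backward_adjoint i : adjoint (Sop i) (backward i).
Proof.
move=> psi phi; apply: (has_sum_lim (V := R[i]^o)).
apply: (@has_sum_reindex R (seq I) (seq I) R[i]^o (cons i)
  (fun w => if w is j :: v then (if j == i then Some v else None) else None)).
- by move=> w /=; rewrite eqxx.
- by move=> [|j w] //=; case: eqP => [->|].
- move=> [|j w] /=; first by rewrite mul0r.
  by case: eqP => // _ _; rewrite !mul0r.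
have := ell2_inner_sum psi (backward i phi).
by congr has_sum; apply/funext => w /=; rewrite eqxx mul1r.
Qed.

Lemma backwardK i : backward i * Sop i = 1.
Proof. by apply: bopP => psi; apply: ell2P => w /=; rewrite eqxx mul1r. Qed.

(* Every algebra closed under adjoints and containing the creation operators
   contains the identity. *)
Lemma star_algebra_unit (i : I) (D : set (bounded_op Fock)) : star_closed D ->
  (forall A B, D A -> D B -> D (A * B)) -> (forall j, D (Sop j)) -> D 1.
Proof.
move=> Dstar DM DS; rewrite -(backwardK i); apply: DM (DS i).
exact: Dstar (backward_adjoint i) (DS i).
Qed.

End BackwardShift.

(* Positivity of the operator on the k-fold direct sum of H given by the matrix X. *)
Definition positive_mx (R : realType) (H : hilbertType R) k (X : 'M[bounded_op H]_k) :=
  forall f : 'I_k -> H, 0 <= \sum_i \sum_j inner (X i j (f j)) (f i).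

(* The C*-algebra generated by the creation operators. Asking for the unit makes it a
   ring; by star_algebra_unit this changes nothing as soon as I is inhabited. *)
Definition cstar_pred (R : realType) (I : choiceType) :
    {pred bounded_op (ell2 R (seq I))} :=
  [pred A | `[< cstar_gen (range (@Sop R I)) A >]].
Arguments cstar_pred : clear implicits.

HB.instance Definition _ (R : realType) (I : choiceType) :=
  GRing.isSubmodClosed.Build R[i] _ (cstar_pred R I) (cstar_gen_submod _).
HB.instance Definition _ (R : realType) (I : choiceType) :=
  GRing.isMulClosed.Build _ (cstar_pred R I) (cstar_gen_mul _).

Record cstar (R : realType) (I : choiceType) :=
  Cstar { cstar_op :> bounded_op (ell2 R (seq I)); _ : cstar_op \in cstar_pred R I }.

HB.instance Definition _ (R : realType) (I : choiceType) := [isSub for @cstar_op R I].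
HB.instance Definition _ (R : realType) (I : choiceType) := [Choice of cstar R I by <:].
HB.instance Definition _ (R : realType) (I : choiceType) :=
  [SubChoice_isSubLmodule of cstar R I by <:].
Lemma cstar_subring (R : realType) (I : choiceType) : subring_closed (cstar_pred R I).
Proof. by split; [exact: rpred1|exact: rpredB|exact: rpredM]. Qed.
HB.instance Definition _ (R : realType) (I : choiceType) :=
  GRing.SubZmodule_isSubPzRing.Build _ _ (cstar R I) (cstar_subring R I).

Section PoissonTransform.
Context {R : realType} {I : choiceType} {H : hilbertType R}.

Lemma cstarS_subproof (i : I) : Sop i \in cstar_pred R I.
Proof. by apply/asboolP; apply: sub_gen_smallest; exists i. Qed.
Definition cstarS (i : I) : cstar R I := Cstar (cstarS_subproof i).

(* The noncommutative disc algebra A_n. *)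
Definition disc_algebra : set (bounded_op (ell2 R (seq I))) :=
  algebra_gen (range (@Sop R I)).

(* A_n A_n^* *)
Definition disc_disc_star : set (bounded_op (ell2 R (seq I))) :=
  [set X | exists A B Bs, [/\ disc_algebra A, disc_algebra B, adjoint B Bs & X = A * Bs]].

Definition completely_positive (mu : cstar R I -> bounded_op H) :=
  forall k (X : 'M[cstar R I]_k),
    positive_mx (map_mx (@cstar_op R I) X) -> positive_mx (map_mx mu X).

Definition poisson_transform (mu : {linear cstar R I -> bounded_op H}) :=
  [/\ mu 1 = 1, completely_positive mu &
      forall A X : cstar R I, disc_algebra A -> disc_disc_star X ->
        mu (A * X) = mu A * mu X].

End PoissonTransform.

Section Moment.
Context {R : realType} {I : choiceType}.

(* Words over I form the free semigroup on I: concatenation is the product and [::] the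
   neutral element. *)
Definition admissible (Sigma : set (seq I)) :=
  forall alpha beta, Sigma (alpha ++ beta) -> Sigma beta.

(* The value sum_w a_w F(w) of a polynomial p = sum_w a_w w, linearly extending F. *)
Definition poly_sum (V : lmodType R[i]) (F : seq I -> V)
    (p : {fsfun seq I -> R[i] with 0}) : V :=
  \sum_(w <- finsupp p) p w *: F w.

Definition Lambda (Sigma : set (seq I)) : set (seq I * seq I) :=
  [set x | Sigma (x.1 ++ x.2)].

Definition psd_kernel (X : choiceType) (K : X -> X -> R[i]) :=
  forall h : {fsfun X -> R[i] with 0},
    0 <= \sum_(x <- finsupp h) \sum_(y <- finsupp h) K x y * h y * (h x)^*.

Definition kernel_le (X : choiceType) (K L : X -> X -> R[i]) :=
  psd_kernel (fun x y => L x y - K x y).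

(* Only the values of M on Sigma matter: by admissibility K3 and K4 evaluate M inside
   Sigma only. *)
Definition K3 (H : hilbertType R) (Sigma : set (seq I)) (M : seq I -> H)
    (x y : Lambda Sigma) : R[i] :=
  let: (alpha, beta) := val x in let: (sigma, gamma) := val y in
  inner (M (sigma ++ gamma)) (M (alpha ++ beta)).

(* For words, sigma <= alpha is prefix sigma alpha, and then alpha \ sigma is
   word_quot alpha sigma. *)
Definition word_lt (sigma alpha : seq I) := prefix sigma alpha && (sigma != alpha).

Definition word_quot (alpha sigma : seq I) := drop (size sigma) alpha.

Definition K4 (H : hilbertType R) (Sigma : set (seq I)) (M : seq I -> H)
    (x y : Lambda Sigma) : R[i] :=
  let: (alpha, beta) := val x in let: (sigma, gamma) := val y in
  if prefix alpha sigma then inner (M (word_quot sigma alpha ++ gamma)) (M beta)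
  else if word_lt sigma alpha then inner (M gamma) (M (word_quot alpha sigma ++ beta))
  else 0.

End Moment.

Arguments K3 {R I H} Sigma M x y.
Arguments K4 {R I H} Sigma M x y.

(* Generators g_1, ..., g_n, where None stands for n = oo. *)
Definition gen (n : option nat) : choiceType :=
  if n is Some m then 'I_m else nat.

(* Main.v *)
Require Import Defs.
From HB Require Import structures.
From mathcomp Require Import all_boot all_order all_algebra finmap.
From mathcomp Require Import sesquilinear complex.
From mathcomp Require Import all_classical all_reals all_analysis.
From mathcomp Require Import ring.
From mathcomp.analysis.showcase Require summability.
Set Implicit Arguments.
Unset Strict Implicit.
Unset Printing Implicit Defensive.
Import Order.TTheory GRing.Theory Num.Theory.
Import numFieldNormedType.Exports.
Local Open Scope classical_set_scope.
Local Open Scope ring_scope.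

#[local] Existing Instance summability.totally_filter.

(* Only the pairs (g_i, s) matter in the hypothesis K3 <= K4: on them it says that
   M(s) |-> M(g_i s) extends to a row contraction T = (T_i). The transform attached to T
   is a limit of Poisson transforms. For finitely many letters J, r < 1 and T' = r T, put
     psi_N(X; h, k) = sum_(a, b) <X e_b, e_a> <D T'_b^* h, T'_a^* k>,
   where D = 1 - sum_(i in J) T'_i T'_i^* and a, b run over the words on J of length less
   than N. Both kernels are positive, so that psi_N is completely positive, and the sum
   telescopes, so that psi_N(1) and psi_N(S_i X) - T'_i psi_N(X) differ from 1 and 0 by
   O(r^N). An ultrafilter limit (J exhausting the letters, r -> 1, r^N -> 0) is a unital
   completely positive mu with mu(S_i X) = T_i mu(X) for all bounded X; hence
   mu(A X) = mu(A) mu(X) for A in the closed algebra generated by the S_i. No square root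
   of D and no infinite sum is needed, and only the adjoints T_i^* are ever constructed.

   Conversely, T_i = mu(S_i) gives M(a b) = mu(S_a) M(b), and the Schwarz inequality
   [mu(S_a)^* mu(S_b)] <= [mu(S_a^* S_b)] evaluated at the vectors M(b) is K3 <= K4. *)

(** * Positive semidefinite sesquilinear forms *)

Section PsdForm.
Context {R : realType}.
Local Notation C := R[i].

(** Degenerate forms are allowed, since the defect form of a row contraction may have isotropic
    vectors. Conjugate linearity in the second variable comes from Hermitian symmetry. *)
Definition psd_form (V : lmodType C) (B : V -> V -> C) :=
  [/\ forall a x y z, B (a *: x + y) z = a * B x z + B y z,
      forall x y, B y x = (B x y)^* & forall x, 0 <= B x x].

Context {V : lmodType C} {B : V -> V -> C}.
Hypothesis B_psd : psd_form B.

Lemma psd_formP a x y z : B (a *: x + y) z = a * B x z + B y z.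
Proof. by case: B_psd. Qed.

Lemma psd_formC x y : B y x = (B x y)^*.
Proof. by case: B_psd. Qed.

Lemma psd_form_ge0 x : 0 <= B x x.
Proof. by case: B_psd. Qed.

Lemma psd_formDl x y z : B (x + y) z = B x z + B y z.
Proof. by rewrite -{1}[x]scale1r psd_formP mul1r. Qed.

Lemma psd_form0l z : B 0 z = 0.
Proof. by apply: (addrI (B 0 z)); rewrite -psd_formDl !addr0. Qed.

Lemma psd_formZl a x z : B (a *: x) z = a * B x z.
Proof. by rewrite -[a *: x]addr0 psd_formP psd_form0l addr0. Qed.

Lemma psd_formPr a x y z : B z (a *: x + y) = a^* * B z x + B z y.
Proof. by rewrite 3!(psd_formC _ z) psd_formP rmorphD rmorphM. Qed.

Lemma psd_formDr x y z : B z (x + y) = B z x + B z y.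
Proof. by rewrite 3!(psd_formC _ z) psd_formDl rmorphD. Qed.

Lemma psd_form0r z : B z 0 = 0.
Proof. by rewrite psd_formC psd_form0l rmorph0. Qed.

Lemma psd_formZr a x z : B z (a *: x) = a^* * B z x.
Proof. by rewrite !(psd_formC _ z) psd_formZl rmorphM. Qed.

Lemma psd_form_suml (J : Type) (r : seq J) (u : J -> V) z :
  B (\sum_(j <- r) u j) z = \sum_(j <- r) B (u j) z.
Proof.
by elim/big_rec2: _ => [|j x y _ <-]; rewrite ?psd_form0l ?psd_formDl.
Qed.

Lemma psd_form_sumr (J : Type) (r : seq J) (u : J -> V) z :
  B z (\sum_(j <- r) u j) = \sum_(j <- r) B z (u j).
Proof. by rewrite psd_formC psd_form_suml rmorph_sum; apply: eq_bigr => j _; rewrite [RHS]psd_formC. Qed.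

Lemma psd_form_CS x y : `|B x y| ^+ 2 <= B x x * B y y.
Proof.
have E a : B (x - a *: y) (x - a *: y) =
    B x x - a^* * B x y - a * (B x y)^* + a * a^* * B y y.
  rewrite -scaleNr !(psd_formDl, psd_formDr, psd_formZl, psd_formZr) rmorphN.
  by rewrite (psd_formC x y); ring.
have xx := psd_form_ge0 x; have yy := psd_form_ge0 y.
have [y0|yN0] := eqVneq (B y y) 0.
  (* For isotropic y the expansion has no quadratic term, and if [B x y] were nonzero this
     coefficient would give it the negative value -(2 + B x x). *)
  have := psd_form_ge0 (x - ((1 + B x x) * B x y / `|B x y| ^+ 2) *: y).
  rewrite E y0 !mulr0 addr0; have [->|b0] := eqVneq (B x y) 0.
    by rewrite normr0 expr0n.
  set N := `|B x y| ^+ 2; have N0 : N != 0 by rewrite expf_neq0 // normr_eq0.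
  have NE : N = B x y * (B x y)^* by rewrite /N normCK.
  have Nr : N^* = N by rewrite NE rmorphM /= conjCK mulrC.
  have xr : (B x x)^* = B x x by rewrite -psd_formC.
  move: N NE Nr N0 => N NE Nr N0.
  rewrite !(rmorphM, fmorphV, rmorphD, rmorph1) /= Nr xr.
  have -> : B x x - (1 + B x x) * (B x y)^* / N * B x y - (1 + B x x) * B x y / N * (B x y)^*
     = B x x - 2 * (1 + B x x) * (B x y * (B x y)^* / N) by ring.
  rewrite -NE divff // mulr1.
  have -> : B x x - 2 * (1 + B x x) = - (2 + B x x) by ring.
  rewrite oppr_ge0 => h.
  by have := lt_le_trans (ltr_wpDr xx (@ltr0n C 2)) h; rewrite ltxx.
have y0 : 0 < B y y by rewrite lt_def yN0.
have := psd_form_ge0 (x - (B x y / B y y) *: y); rewrite E.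
have yr : (B y y)^* = B y y by rewrite -psd_formC.
rewrite !(rmorphM, fmorphV) /= yr normCK => h.
rewrite -subr_ge0.
have -> : B x x * B y y - B x y * (B x y)^* = B y y * (B x x - (B x y)^* / B y y * B x y -
     B x y / B y y * (B x y)^* + B x y / B y y * ((B x y)^* / B y y) * B y y).
  by field.
by rewrite mulr_ge0.
Qed.

Lemma psd_form_isotropic x y : B x x = 0 -> B x y = 0.
Proof.
move=> x0; have := psd_form_CS x y; rewrite x0 mul0r => h.
by apply/eqP; rewrite -normr_eq0 -sqrf_eq0 eq_le h exprn_ge0.
Qed.

End PsdForm.

(** * Inner product calculus *)

Section HilbertSpace.
Context {R : realType} {H : hilbertType R}.
Local Notation C := R[i].
Implicit Types (x y z : H).

Lemma inner_psd : psd_form (fun x y : H => inner x y).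
Proof.
split=> [a x y z|x y|x].
- by rewrite linearDl linearZl_LR.
- by rewrite hermC /= expr0 mul1r.
- by rewrite inner_norm exprn_ge0.
Qed.

Lemma innerDl x y z : inner (x + y) z = inner x z + inner y z.
Proof. exact: (psd_formDl inner_psd). Qed.
Lemma innerDr x y z : inner z (x + y) = inner z x + inner z y.
Proof. exact: (psd_formDr inner_psd). Qed.
Lemma innerZl a x z : inner (a *: x) z = a * inner x z.
Proof. exact: (psd_formZl inner_psd). Qed.
Lemma innerZr a x z : inner z (a *: x) = a^* * inner z x.
Proof. exact: (psd_formZr inner_psd). Qed.
Lemma innerC x y : inner y x = (inner x y)^*.
Proof. exact: (psd_formC inner_psd). Qed.
Lemma inner0l z : inner 0 z = 0 :> C.
Proof. exact: (psd_form0l inner_psd). Qed.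
Lemma inner0r z : inner z 0 = 0 :> C.
Proof. exact: (psd_form0r inner_psd). Qed.
Lemma innerNl x z : inner (- x) z = - inner x z.
Proof. by rewrite -scaleN1r innerZl mulN1r. Qed.
Lemma innerNr x z : inner z (- x) = - inner z x.
Proof. by rewrite 2!(innerC _ z) innerNl rmorphN. Qed.
Lemma innerBl x y z : inner (x - y) z = inner x z - inner y z.
Proof. by rewrite innerDl innerNl. Qed.
Lemma innerBr x y z : inner z (x - y) = inner z x - inner z y.
Proof. by rewrite innerDr innerNr. Qed.
Lemma inner_suml (J : Type) (r : seq J) (u : J -> H) z :
  inner (\sum_(j <- r) u j) z = \sum_(j <- r) inner (u j) z.
Proof. exact: (psd_form_suml inner_psd). Qed.
Lemma inner_sumr (J : Type) (r : seq J) (u : J -> H) z :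
  inner z (\sum_(j <- r) u j) = \sum_(j <- r) inner z (u j).
Proof. exact: (psd_form_sumr inner_psd). Qed.

Lemma inner_le x y : `|inner x y| <= `|x| * `|y|.
Proof.
rewrite -ler_sqr ?nnegrE ?mulr_ge0 // exprMn -!inner_norm.
exact: (psd_form_CS inner_psd).
Qed.

Lemma inner_inj x y : (forall z, inner x z = inner y z) -> x = y.
Proof.
move=> xy; apply/eqP; rewrite -subr_eq0 -normr_eq0 -sqrf_eq0 -inner_norm.
by rewrite {1}innerBl xy subrr.
Qed.

End HilbertSpace.

(** * Riesz representation of functionals given by linear relations *)

Lemma norm_le_eq0 (K : numFieldType) (V : normedZmodType K) (x : V) :
  (forall e : K, 0 < e -> `|x| <= e) -> x = 0.
Proof.
move=> xe; apply/eqP; rewrite -normr_eq0; apply/negPn/negP => x0.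
have xp : 0 < `|x| by rewrite lt_def x0 normr_ge0.
have := xe (`|x| / 2) (divr_gt0 xp (ltr0n K 2)).
by rewrite ler_pdivlMr // mulr_natr mulr2n gerDl normr_le0 -normr_eq0 (negbTE x0).
Qed.

Section Riesz.
Context {R : realType} {H : hilbertType R}.
Local Notation C := R[i].

(** The difference w - w' is orthogonal to D and is a limit of differences of elements of D, hence
    is orthogonal to itself. *)
Lemma dense_inner_inj (D : set H) (w w' : H) : closure D w -> closure D w' ->
  (forall x, D x -> inner x w = inner x w') -> w = w'.
Proof.
move=> cw cw' ww'; apply/eqP; rewrite -subr_eq0; apply/eqP/norm_le_eq0 => e e0.
pose d := w - w'; rewrite -/d.
have e2 : 0 < e / 2 by rewrite divr_gt0.
have [x [Dx xw]] := cw _ (nbhsx_ballx w _ e2).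
have [x' [Dx' xw']] := cw' _ (nbhsx_ballx w' _ e2).
have dx : inner (x - x') d = 0 by rewrite innerBl !innerBr !ww' // !subrr.
have hd : `|d - (x - x')| <= e.
  have -> : d - (x - x') = (w - x) - (w' - x') by rewrite /d !opprB (addrC x') addrACA (addrC (- w')).
  rewrite (le_trans (ler_normB _ _)) // [e]splitr lerD // ltW //.
  + by move: xw; rewrite -ball_normE.
  + by move: xw'; rewrite -ball_normE.
have [->|d0] := eqVneq d 0; first by rewrite normr0 ltW.
rewrite -(@ler_pM2r _ `|d|) ?normr_gt0 // -expr2 -inner_norm.
have -> : inner d d = inner (d - (x - x')) d by rewrite innerBl dx subr0.
rewrite -[leLHS]ger0_norm ?(le_trans (inner_le _ _)) ?ler_wpM2r //.
by rewrite innerBl dx subr0 inner_norm exprn_ge0.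
Qed.

Let J (p : H * C) : C := `|p.1| ^+ 2 - (p.2 + p.2^*).

Let J_real p : J p = ((complex.Re (J p))%:C)%C.
Proof.
apply/esym/RRe_real; rewrite rpredB ?realX ?normr_real //.
by rewrite CrealE rmorphD /= conjCK addrC.
Qed.

(* The representing vector is the limit of the minimizing sequences of
   |x|^2 - 2 Re c over the pairs (x, c) of the relation. *)
Lemma riesz_relation (G : set (H * C)) (K : C) : 0 <= K -> G (0, 0) ->
  (forall a p q, G p -> G q -> G (a *: p.1 + q.1, a * p.2 + q.2)) ->
  (forall p, G p -> `|p.2| <= K * `|p.1|) ->
  exists w, (forall x c, G (x, c) -> inner x w = c) /\
    closure [set x | exists c, G (x, c)] w.
Proof.
move=> K0 G0 GP GK; pose P := [set complex.Re (J p) | p in G].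
have P0 : P !=set0 by exists (complex.Re (J (0, 0))), (0, 0).
have Plb : has_lbound P.
  (* As 2 Re c <= 2 K |x|, [J] is at least (|x| - K)^2 - K^2. *)
  exists (complex.Re (- K ^+ 2)) => _ [p Gp <-]; rewrite -lecR -J_real RRe_real; last first.
    by rewrite rpredN realX ?ger0_real.
  have h : p.2 + p.2^* <= 2 * (K * `|p.1|).
    rewrite -[leLHS](divfK (negbT (pnatr_eq0 C 2))) mulrC ler_pM2l //.
    rewrite -ReE; have [h _] := leif_Re_Creal p.2.
    exact: le_trans h (GK _ Gp).
  rewrite /J -subr_ge0.
  have -> : `|p.1| ^+ 2 - (p.2 + p.2^*) - - K ^+ 2 =
     (`|p.1| - K) ^+ 2 + (2 * (K * `|p.1|) - (p.2 + p.2^*)) by ring.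
  by rewrite addr_ge0 ?subr_ge0 // real_exprn_even_ge0 // rpredB ?ger0_real.
have Pinf : has_inf P by split.
pose L m (e : R) := [set p | G p /\ J p <= ((m + e)%:C)%C].
have [m mJ L0] : exists2 m, (forall p, G p -> (m%:C)%C <= J p)
    & forall e, 0 < e -> exists p, L m e p.
  exists (inf P) => [p Gp|e e0].
    by rewrite J_real lecR; apply: ge_inf => //; exists p.
  have [_ [p Gp <-] pe] := inf_adherent e0 Pinf.
  by exists p; split => //; rewrite J_real lecR ltW.
(* First variation: with d = <x, p.1> - c and s = 1 / (|x|^2 + 1), adding -s conj(d) times (x, c) to
   p lowers [J] by at least s |d|^2. For an e-minimizer this drop is at most e. *)
have Lvar e p x c : L m e p -> G (x, c) -> `|inner x p.1 - c| ^+ 2 <= (e%:C)%C * (`|x| ^+ 2 + 1).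
  move=> [Gp pe] Gx.
  have [d dE] : exists d, d = inner x p.1 - c by eexists.
  rewrite -dE; have {}dE : inner x p.1 = d + c by rewrite dE subrK.
  have q0 : 0 < `|x| ^+ 2 + 1 by rewrite ltr_wpDl ?exprn_ge0.
  have [s sq] : exists s, s = (`|x| ^+ 2 + 1)^-1 by eexists.
  have s0 : 0 < s by rewrite sq invr_gt0.
  have sr : s^* = s by rewrite conj_Creal // ger0_real // ltW.
  have := mJ _ (GP (- (s * d^*)) (x, c) p Gx Gp).
  rewrite /J /= -inner_norm !(innerDl, innerDr, innerZl, innerZr) !inner_norm.
  rewrite (innerC x p.1) dE !(rmorphD, rmorphN, rmorphM) /= conjCK sr => h.
  rewrite rmorphD /= in pe.
  have h2 : s * `|d| ^+ 2 <= (e%:C)%C.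
    have h2 : (m%:C)%C <= `|p.1| ^+ 2 - (p.2 + p.2^*) - s * `|d| ^+ 2.
      apply: le_trans h _; rewrite -subr_ge0.
      rewrite (_ : _ - _ = s * `|d| ^+ 2 * (1 - s * `|x| ^+ 2)); last first.
        by rewrite normCK; ring.
      rewrite mulr_ge0 ?mulr_ge0 ?exprn_ge0 ?(ltW s0) // subr_ge0 sq mulrC ler_pdivrMr // mul1r.
      by rewrite lerDl.
    rewrite -(lerD2l (m%:C)%C); apply: le_trans _ pe.
    by rewrite -lerBrDr.
  by rewrite -ler_pdivrMr // -sq mulrC.
(* Parallelogram identity: [J p + J q] is twice the value at the midpoint, itself at least m, plus
   |p.1 - q.1|^2 / 2. *)
have Lpar e p q : L m e p -> L m e q -> `|p.1 - q.1| ^+ 2 <= 4 * (e%:C)%C.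
  move=> [Gp pe] [Gq qe].
  have Gh p' : G p' -> G (2^-1 *: p'.1, 2^-1 * p'.2).
    by move=> Gp'; have := GP (2^-1) p' (0, 0) Gp' G0; rewrite /= !addr0.
  have := mJ _ (GP (2^-1) p _ Gp (Gh q Gq)).
  have h2 : (2^-1 : C)^* = 2^-1 by rewrite fmorphV rmorph_nat.
  rewrite /J /= -scalerDr normrZ exprMn ger0_norm // -inner_norm.
  rewrite !(rmorphD, rmorphM) /= h2 => h.
  have : (m%:C)%C + (m%:C)%C + `|p.1 - q.1| ^+ 2 / 2 <= J p + J q.
    rewrite -!inner_norm innerBl !innerBr.
    rewrite /J -!inner_norm.
    move: h; rewrite innerDl !innerDr.
    move: (inner p.1 q.1) (inner q.1 p.1) (inner p.1 p.1) (inner q.1 q.1) => a b u v.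
    rewrite -subr_ge0; set h := (X in 0 <= X) => h0.
    rewrite -subr_ge0 (_ : _ - _ = 2 * h); last by rewrite /h; field.
    by rewrite mulr_ge0.
  move=> h3; have := le_trans h3 (lerD pe qe); rewrite rmorphD /= addrACA lerD2l.
  rewrite ler_pdivrMr // => h4; apply: le_trans h4 _.
  by rewrite le_eqVlt; apply/orP; left; apply/eqP; ring.
pose F := filter_from [set e : R | 0 < e] (fun e => [set p.1 | p in L m e]).
have FF : ProperFilter F.
  apply: filter_from_proper => [|e e0]; last by have [p Lp] := L0 e e0; exists p.1, p.
  apply: filter_from_filter; first by exists 1 => /=.
  move=> e e' e0 e0'; exists (Num.min e e'); first by rewrite /= lt_min e0 e0'.
  move=> _ [p [Gp pe] <-]; split; exists p => //; split=> //; apply: le_trans pe _.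
    by rewrite lecR lerD2l ge_min lexx.
  by rewrite lecR lerD2l ge_min lexx orbT.
have /cauchy_cvg Fc : cauchy F.
  apply/cauchyP => e e0.
  have eE : e = ((complex.Re e)%:C)%C by rewrite RRe_real // gtr0_real.
  pose e1 := complex.Re e ^+ 2 / 8.
  have Re0 : 0 < complex.Re e by rewrite -ltcR -eE.
  have e10 : 0 < e1 by rewrite divr_gt0 // exprn_gt0.
  have [p Lp] := L0 _ e10; exists p.1; exists e1 => // _ [q Lq <-].
  rewrite -ball_normE /= -ltr_sqr ?nnegrE ?(ltW e0) //.
  apply: le_lt_trans (Lpar _ _ _ Lp Lq) _.
  rewrite /e1 rmorphM fmorphV rmorphXn /= -eE rmorph_nat.
  have -> : 4 * (e ^+ 2 / 8) = e ^+ 2 / 2 by field.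
  by rewrite ltr_pdivrMr // ltr_pMr ?exprn_gt0 // ltr1n.
have /cvg_ex[w {}Fc] := Fc.
exists w; split=> [x c Gx|B nB]; last first.
  have FB : F B := Fc B nB.
  have [y [[p [Gp _] <-] By]] : [set p.1 | p in L m 1] `&` B !=set0.
    apply: (filter_ex (F := F)); apply: filterI FB; exists 1 => //=.
  by exists p.1; split => //; exists p.2; rewrite -surjective_pairing.
apply/eqP; rewrite -subr_eq0; apply/eqP/norm_le_eq0 => e e0.
have eE : e = ((complex.Re e)%:C)%C by rewrite RRe_real // gtr0_real.
have Re0 : 0 < complex.Re e by rewrite -ltcR -eE.
set a := `|x| ^+ 2 + 1; have a0 : 0 < a by rewrite ltr_wpDl ?exprn_ge0.
have aE : a = ((complex.Re a)%:C)%C by rewrite RRe_real // gtr0_real.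
have Ra0 : 0 < complex.Re a by rewrite -ltcR -aE.
(* Chosen so that the bound of [Lvar] becomes (e / 2)^2. *)
pose e1 := (complex.Re e / 2) ^+ 2 / complex.Re a.
have e10 : 0 < e1 by rewrite divr_gt0 // exprn_gt0 // divr_gt0.
have e20 : 0 < e / 2 / (`|x| + 1) by rewrite !divr_gt0 // ltr_wpDl.
have [y [[p Lp <-] pw]] : [set p.1 | p in L m e1] `&` ball w (e / 2 / (`|x| + 1)) !=set0.
  apply: (filter_ex (F := F)); apply: filterI; first by exists e1.
  by apply: Fc; exact: nbhsx_ballx w _ e20.
have -> : inner x w - c = inner x (w - p.1) + (inner x p.1 - c).
  by rewrite innerBr; ring.
rewrite (le_trans (ler_normD _ _)) // [e]splitr lerD //.
  rewrite (le_trans (inner_le _ _)) //.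
  apply: (@le_trans _ _ ((`|x| + 1) * `|w - p.1|)); first by rewrite ler_wpM2r // lerDl.
  by rewrite mulrC -ler_pdivlMr ?ltr_wpDl // ltW //; move: pw; rewrite -ball_normE.
rewrite -ler_sqr ?nnegrE ?divr_ge0 ?(ltW e0) //; apply: le_trans (Lvar _ _ _ _ Lp Gx) _.
rewrite -/a /e1 rmorphM fmorphV rmorphXn rmorphM /= fmorphV rmorph_nat -eE -aE.
by rewrite divfK // gt_eqF.
Qed.

Lemma riesz (f : H -> C) (K : C) : 0 <= K ->
  (forall a x y, f (a *: x + y) = a * f x + f y) -> (forall x, `|f x| <= K * `|x|) ->
  exists w, forall x, inner x w = f x.
Proof.
move=> K0 fP fK; have f0 : f 0 = 0.
  by have := fP (- 1) 0 0; rewrite scaler0 addr0 mulN1r addNr.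
have [||p /= ->|w [wP _]] := @riesz_relation [set p | p.2 = f p.1] K K0 => //=.
- by move=> a p q -> ->; rewrite fP.
- by exists w => x; apply: wP.
Qed.

End Riesz.

(** * The adjoint of a partially defined row contraction *)

Section RowAdjoint.
Context {R : realType} {H : hilbertType R} {I : choiceType}.
Local Notation C := R[i].

Lemma closure_normP (D : set H) (w : H) :
  closure D w <-> forall e : C, 0 < e -> exists2 x, D x & `|w - x| < e.
Proof.
split=> [Dw e e0|Dw B /nbhs_ballP[e /= e0 eB]].
  by have [x [Dx]] := Dw _ (nbhsx_ballx w _ e0); rewrite -ball_normE; exists x.
by have [x Dx wx] := Dw e e0; exists x; split=> //; apply: eB; rewrite -ball_normE.
Qed.

Lemma closure_linear (D : set H) : (forall a x y, D x -> D y -> D (a *: x + y)) ->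
  forall a x y, closure D x -> closure D y -> closure D (a *: x + y).
Proof.
move=> DP a x y /closure_normP Dx /closure_normP Dy; apply/closure_normP => e e0.
have a1 : 0 < `|a| + 1 by rewrite ltr_wpDl.
have e1 : 0 < e / 2 / (`|a| + 1) by rewrite !divr_gt0.
have [x' Dx' xx'] := Dx _ e1.
have [y' Dy' yy'] := Dy _ (divr_gt0 e0 (ltr0n C 2)).
exists (a *: x' + y'); first exact: DP.
rewrite opprD addrACA -scalerBr [e]splitr (le_lt_trans (ler_normD _ _)) //.
rewrite ler_ltD // normrZ.
apply: (@le_trans _ _ ((`|a| + 1) * `|x - x'|)); first by rewrite ler_wpM2r // lerDl.
by rewrite mulrC -ler_pdivlMr // ltW.
Qed.

(* The adjoint of the row operator sending (x_i) to the sum of the y_i, (x_i, y_i) in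
   G_i, extended by 0 to the orthogonal complement of its domain. *)
Lemma row_adjoint (G : I -> set (H * H)) : (forall i, G i (0, 0)) ->
  (forall i a p q, G i p -> G i q -> G i (a *: p.1 + q.1, a *: p.2 + q.2)) ->
  (forall (J : seq I) (x y : I -> H), uniq J -> (forall i, G i (x i, y i)) ->
     `|\sum_(i <- J) y i| ^+ 2 <= \sum_(i <- J) `|x i| ^+ 2) ->
  exists T : I -> H -> H, [/\ forall i a h k, T i (a *: h + k) = a *: T i h + T i k,
    forall (J : seq I) k, uniq J -> \sum_(i <- J) `|T i k| ^+ 2 <= `|k| ^+ 2 &
    forall i x y k, G i (x, y) -> inner x (T i k) = inner y k].
Proof.
move=> G0 GP Gle.
have G1 i x y : G i (x, y) -> `|y| <= `|x|.
  move=> Gxy; rewrite -ler_sqr ?nnegrE //.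
  have := Gle [:: i] (fun j => if j == i then x else 0) (fun j => if j == i then y else 0) isT.
  by rewrite !big_seq1 eqxx; apply=> j; case: eqP => [->|_].
pose D i := [set x | exists y, G i (x, y)].
have DP i a x y : D i x -> D i y -> D i (a *: x + y).
  by move=> [x' Gx] [y' Gy]; exists (a *: x' + y'); exact: (GP i a _ _ Gx Gy).
(* The vector representing x |-> <y, k> on the domain of G_i is sought in the closure of that
   domain: there it is unique, which gives linearity, and it can be approximated by the x_i of the
   contraction estimate. *)
have /choice[T TP] (ik : I * H) : exists w,
    closure (D ik.1) w /\ forall x y, G ik.1 (x, y) -> inner x w = inner y ik.2.
  case: ik => i k /=.
  have [|a p q [y [Gy py]] [y' [Gy' qy']]|p [y [Gy ->]]|w [wG Dw]] := @riesz_relation R H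
    [set p | exists y, G i (p.1, y) /\ p.2 = inner y k] `|k| (normr_ge0 _).
  - by exists 0; rewrite inner0l.
  - exists (a *: y + y'); rewrite /= py qy' innerDl innerZl; split => //.
    exact: (GP _ _ _ _ Gy Gy').
  - by rewrite (le_trans (inner_le _ _)) // mulrC ler_wpM2l // (G1 i).
  exists w; split=> [|x y Gxy]; last by apply: wG; exists y.
  apply/closure_normP => e /(proj1 (closure_normP _ _) Dw)[x [c [y [Gxy _]] xw]].
  by exists x => //; exists y.
exists (fun i k => T (i, k)); split=> [i a h k|J k uJ|i x y k Gxy]; last first.
- exact: (proj2 (TP (i, k))).
- apply/ler_addgt0Pr => e e0.
  have n0 : 0 < (size J)%:R + 1 :> C by rewrite ltr_wpDl.
  have n1 : 0 < (size J)%:R + 1 + e by rewrite addr_gt0.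
  (* This tolerance t satisfies t <= 1 and [size J] t <= e, so that the errors t^2 add up to at most
     e. *)
  have e1 : 0 < e / ((size J)%:R + 1 + e) by rewrite divr_gt0.
  have /choice[x xP] i : exists x, D i x /\ `|T (i, k) - x| < e / ((size J)%:R + 1 + e).
    by have [/closure_normP/(_ _ e1)[x]] := TP (i, k); exists x.
  have /choice[y yP] i : exists y, G i (x i, y) by have [] := xP i.
  have := Gle J x y uJ yP; rewrite -!inner_norm => Gxy.
  (* Expanding this square gives 2 Re sum <x_i, T_i k> <= sum |x_i|^2 + |k|^2, and by the identity
     [E] sum |T_i k|^2 exceeds |k|^2 by at most sum |T_i k - x_i|^2. *)
  have := exprn_ge0 2 (normr_ge0 (\sum_(i <- J) y i - k)).
  rewrite -inner_norm innerBl !innerBr.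
  have yk : inner (\sum_(i <- J) y i) k = \sum_(i <- J) inner (x i) (T (i, k)).
    by rewrite inner_suml; apply: eq_bigr => i _; rewrite (proj2 (TP (i, k)) _ _ (yP i)).
  rewrite (innerC (\sum_(i <- J) y i) k) yk rmorph_sum /= => h.
  have {}h : \sum_(i <- J) (inner (x i) (T (i, k)) + (inner (x i) (T (i, k)))^*)
      <= \sum_(i <- J) `|x i| ^+ 2 + inner k k.
    apply: le_trans (lerD Gxy (lexx _)); rewrite big_split /= -subr_ge0.
    by apply: le_trans h _; rewrite le_eqVlt; apply/orP; left; apply/eqP; ring.
  have E i : `|T (i, k)| ^+ 2 = inner (x i) (T (i, k)) + (inner (x i) (T (i, k)))^*
      - `|x i| ^+ 2 + `|T (i, k) - x i| ^+ 2.
    by rewrite -!inner_norm innerBl !innerBr (innerC (x i) (T (i, k))); ring.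
  under eq_bigr do rewrite E.
  rewrite big_split sumrB /= lerD //; first by rewrite lerBlDl.
  have h1 : e / ((size J)%:R + 1 + e) <= 1.
    by rewrite (ler_pdivrMr _ _ n1) mul1r lerDr ltW.
  apply: (@le_trans _ _ (\sum_(i <- J) e / ((size J)%:R + 1 + e))).
    apply: ler_sum => i _; have [_ /ltW xT] := xP i.
    by rewrite (le_trans _ xT) // expr2 ler_piMr // (le_trans xT).
  rewrite big_const_seq count_predT iter_addr_0 -[leLHS]mulr_natr mulrAC (ler_pdivrMr _ _ n1).
  by rewrite ler_wpM2l ?(ltW e0) // -addrA lerDl addr_ge0 // ltW.
- apply: (@dense_inner_inj _ _ (D i)).
  + exact: (proj1 (TP (i, _))).
  + by apply: (closure_linear (DP i)); apply: (proj1 (TP (i, _))).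
  + move=> x [y Gxy]; rewrite innerDr innerZr !(proj2 (TP (i, _)) _ _ Gxy).
    by rewrite innerDr innerZr.
Qed.

End RowAdjoint.

(** * Gram decomposition of a form on finitely many vectors *)

Section Gram.
Context {R : realType}.
Local Notation C := R[i].

(* Cholesky decomposition. That the functionals kill the isotropic vectors is what
   makes the induction go through. *)
Lemma gram_decomposition (V : lmodType C) (B : V -> V -> C) (s : seq V) : psd_form B ->
  exists d (l : 'I_d -> V -> C), (forall j z, B z z = 0 -> l j z = 0) /\
    {in s &, forall x y, B x y = \sum_j l j x * (l j y)^*}.
Proof.
elim: s B => [|w s IHs] B B_psd.
  by exists 0%N, (fun _ _ => 0); split.
have w0 := psd_form_ge0 B_psd w.
have [q [q0 qq]] : exists q : C, 0 <= q /\ q ^+ 2 = B w w.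
  by exists (sqrtC (B w w)); rewrite sqrtCK sqrtC_ge0.
have qr : q^* = q by rewrite conj_Creal ?ger0_real.
(* If [B w w] = 0, then [q] = 0 and division by zero makes [l0] vanish. *)
have [l0 l0E l0_iso] : exists2 l0, forall x y, l0 x * (l0 y)^* = B x w * (B y w)^* / B w w
    & forall z, B z z = 0 -> l0 z = 0.
  exists (fun x => B x w / q) => [x y|z zz]; last first.
    by rewrite (psd_form_isotropic B_psd) // mul0r.
  by rewrite rmorphM fmorphV /= qr -qq expr2 invfM; ring.
(* The Schur complement of w is positive by the Cauchy-Schwarz inequality. It has w as an isotropic
   vector, so both sides of the decomposition vanish on pairs involving w. *)
pose B' x y := B x y - l0 x * (l0 y)^*.
have B'_psd : psd_form B'.
  split=> [a x y z|x y|x]; rewrite /B'.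
  - by rewrite !l0E !(psd_formP B_psd); ring.
  - by rewrite rmorphB rmorphM /= conjCK -(psd_formC B_psd) mulrC.
  - rewrite l0E -normCK subr_ge0; have [ww|wN] := eqVneq (B w w) 0.
      by rewrite ww invr0 mulr0 (psd_form_ge0 B_psd).
    by rewrite ler_pdivrMr ?lt_def ?wN //; exact: (psd_form_CS B_psd).
have iso z : B z z = 0 -> l0 z = 0 /\ B' z z = 0.
  by move=> zz; have lz := l0_iso z zz; rewrite /B' lz zz mul0r subr0.
have B'w : B' w w = 0.
  rewrite /B' l0E -(psd_formC B_psd); have [->|wN] := eqVneq (B w w) 0.
    by rewrite !mul0r subr0.
  by rewrite mulfK // subrr.
have [d [l [lz ls]]] := IHs B' B'_psd.
exists d.+1, (fun j => if unlift ord0 j is Some j' then l j' else l0); split.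
  by move=> j z /iso[l0z z0]; case: unliftP => [j'|] _ //; exact: lz.
have B'E x y : x \in w :: s -> y \in w :: s -> B' x y = \sum_j l j x * (l j y)^*.
  have [->|xw] := eqVneq x w.
    move=> _ _; rewrite (psd_form_isotropic B'_psd) // big1 // => j _.
    by rewrite (lz _ w) // mul0r.
  have [->|yw] := eqVneq y w.
    move=> _ _; rewrite (psd_formC B'_psd) (psd_form_isotropic B'_psd) // rmorph0 big1 // => j _.
    by rewrite (lz _ w) // rmorph0 mulr0.
  by rewrite !inE (negbTE xw) (negbTE yw) /= => xs ys; exact: ls.
move=> x y xs ys; rewrite big_ord_recl unlift_none /=.
under eq_bigr do rewrite liftK.
by rewrite -B'E // /B' addrC subrK.
Qed.

End Gram.

(** * Forms on the tensor product with the Fock space *)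

Section TensorForm.
Context {R : realType} {I : choiceType}.
Local Notation C := R[i].
Local Notation Fock := (ell2 R (seq I)).
Implicit Types (X Y : bounded_op Fock).

Lemma inner_ebasis (psi : Fock) (w : seq I) : inner psi (ebasis w) = psi w.
Proof.
apply: (has_sum_lim (V := C^o)); apply/cvgrPdist_le => e e0.
exists [fset w]%fset => // A /= /fsubsetP/(_ w (fset11 w)) wA.
rewrite partial_sumE (big_fsetD1 w) //= eqxx rmorph1 mulr1 big_seq big1 => [|v].
  by rewrite addr0 subrr normr0 ltW.
by rewrite !inE => /andP[/negbTE -> _]; rewrite rmorph0 mulr0.
Qed.

Context {V : lmodType C}.
Implicit Types (F : seq (seq I)) (B : V -> V -> C) (u v : seq I -> V).

(* The form of X (x) B on the vectors sum_(b in F) e_b (x) u_b of the tensor product of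
   the Fock space and of V. *)
Definition tensor_form F B X u v : C :=
  \sum_(a <- F) \sum_(b <- F) X (ebasis b) a * B (u b) (v a).

(** A Gram decomposition of [B] on the finitely many vectors u_i(b) replaces V by C^d, and the form
    of X (x) B becomes a sum of d copies of the form of X. *)
Lemma tensor_form_diag F B (T : finType) (u : T -> seq I -> V) : psd_form B ->
  exists d (g : 'I_d -> T -> Fock), forall X i j,
    tensor_form F B X (u j) (u i) = \sum_l inner (X (g l j)) (g l i).
Proof.
move=> B_psd; have [d [l [_ lE]]] := gram_decomposition [seq u i b | i <- enum T, b <- F] B_psd.
exists d, (fun m i => \sum_(b <- F) l m (u i b) *: ebasis b) => X i j.
have uF k b : b \in F -> u k b \in [seq u i b | i <- enum T, b <- F].
  by move=> bF; apply/allpairsP; exists (k, b); split=> //=; rewrite mem_enum.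
transitivity (\sum_(a <- F) \sum_(b <- F) \sum_m
    l m (u j b) * (l m (u i a))^* * inner (X (ebasis b)) (ebasis a)).
  rewrite /tensor_form !big_seq; apply: eq_bigr => a aF.
  rewrite !big_seq; apply: eq_bigr => b bF.
  by rewrite lE ?uF // mulr_sumr; apply: eq_bigr => m _; rewrite inner_ebasis mulrC.
under eq_bigr do rewrite exchange_big /=.
rewrite exchange_big /=; apply: eq_bigr => m _.
rewrite inner_sumr; apply: eq_bigr => a _.
rewrite linear_sum /= inner_suml; apply: eq_bigr => b _.
by rewrite innerZr linearZ /= innerZl mulrCA mulrA.
Qed.

Lemma tensor_form_cp F B k (X : 'M[bounded_op Fock]_k) (u : 'I_k -> seq I -> V) :
  psd_form B -> positive_mx X ->
  0 <= \sum_i \sum_j tensor_form F B (X i j) (u j) (u i).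
Proof.
move=> B_psd X0; have [d [g gE]] := tensor_form_diag F u B_psd.
under eq_bigr do under eq_bigr do rewrite gE.
under eq_bigr do rewrite exchange_big /=.
by rewrite exchange_big /= sumr_ge0 // => l _; exact: X0.
Qed.

Lemma tensor_form_CS F B X u v : psd_form B ->
  `|tensor_form F B X u v| ^+ 2 <=
  `|X| ^+ 2 * tensor_form F B 1 u u * tensor_form F B 1 v v.
Proof.
(* Indexing by [bool] diagonalizes for u and v simultaneously. *)
move=> B_psd; have [d [g gE]] := tensor_form_diag F (fun b : bool => if b then u else v) B_psd.
have E Y b b' := gE Y b b'.
have := E X false true; have := E 1 true true; have := E 1 false false => /= -> -> ->.
pose S (x y : 'I_d -> Fock) : C := \sum_l inner (x l) (y l).
have S_psd : psd_form S.
  split=> [a x y z|x y|x]; rewrite /S.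
  - rewrite mulr_sumr -big_split /=; apply: eq_bigr => l _.
    by rewrite -innerZl -innerDl.
  - by rewrite rmorph_sum; apply: eq_bigr => l _; exact: innerC.
  - by rewrite sumr_ge0 // => l _; exact: (psd_form_ge0 inner_psd).
apply: le_trans (psd_form_CS S_psd (fun l => X (g l true)) (fun l => g l false)) _.
apply: ler_wpM2r; first exact: (psd_form_ge0 S_psd).
rewrite mulr_sumr; apply: ler_sum => l _.
by rewrite !inner_norm -exprMn ler_sqr ?nnegrE ?mulr_ge0 //; exact: opnormP.
Qed.

End TensorForm.

(** * Words of bounded length *)

Section Words.
Context {I : choiceType}.
Implicit Types (J : seq I).

(** The bound is strict: [words J N] stops just before the words of length N, which form
    [level J N]. *)
Fixpoint words J N : seq (seq I) :=
  if N is N'.+1 then [::] :: [seq i :: w | i <- J, w <- words J N'] else [::].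

Fixpoint level J N : seq (seq I) :=
  if N is N'.+1 then [seq i :: w | i <- J, w <- level J N'] else [:: [::]].

Lemma words_uniq J N : uniq J -> uniq (words J N).
Proof.
move=> uJ; elim: N => //= N uN; apply/andP; split.
  by apply/allpairsP => -[[? ?] []].
by apply: allpairs_uniq => // -[i v] [j w] _ _ /= [-> ->].
Qed.

Lemma size_words J N w : w \in words J N -> (size w < N)%N.
Proof.
elim: N w => //= N IHN w; rewrite inE => /predU1P[->//|/allpairsP[[i v] [_ /IHN]]].
by move=> /= sv ->.
Qed.

Lemma size_level J N w : w \in level J N -> size w = N.
Proof.
elim: N w => [|N IHN] w /=; first by rewrite inE => /eqP ->.
by move=> /allpairsP[[i v] [_ /IHN /= <- ->]].
Qed.

Context {V : nmodType} (f : seq I -> V).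

Lemma big_words_recl J N : \sum_(w <- words J N.+1) f w =
  f [::] + \sum_(i <- J) \sum_(w <- words J N) f (i :: w).
Proof. by rewrite /= big_cons big_allpairs_dep. Qed.

Lemma big_level_recl J N : \sum_(w <- level J N.+1) f w =
  \sum_(i <- J) \sum_(w <- level J N) f (i :: w).
Proof. by rewrite /= big_allpairs_dep. Qed.

End Words.

(** Recursion on the first letter matches [word_act] and [Sop], while peeling off the longest words,
    as here, isolates the truncation error. *)
Lemma big_words_recr {I : choiceType} {V : nmodType} (f : seq I -> V) J N :
  \sum_(w <- words J N.+1) f w = \sum_(w <- words J N) f w + \sum_(w <- level J N) f w.
Proof.
elim: N f => [|N IHN] f.
  rewrite big_words_recl big1 => [|i _]; last by rewrite big_nil.
  by rewrite big_nil big_seq1 addr0 add0r.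
rewrite big_words_recl [in RHS]big_words_recl big_level_recl -addrA -big_split /=.
by congr (_ + _); apply: eq_bigr => i _; rewrite -IHN.
Qed.

(** * Truncated Poisson kernels of a strict row contraction *)

Section PoissonKernel.
Context {R : realType} {I : choiceType} {H : hilbertType R}.
Local Notation C := R[i].
Local Notation Fock := (ell2 R (seq I)).

(* T i plays the role of the adjoint of the i-th entry of a row contraction, hence the
   words act from left to right. *)
Context (T : I -> H -> H) (J : seq I) (c : C).
Hypothesis T_lin : forall i a h k, T i (a *: h + k) = a *: T i h + T i k.
Hypothesis J_uniq : uniq J.
Hypothesis c_ge0 : 0 <= c.
Hypothesis c_le1 : c <= 1.
Hypothesis T_le : forall k, \sum_(i <- J) `|T i k| ^+ 2 <= c * `|k| ^+ 2.

Definition word_act (w : seq I) (k : H) : H := foldl (fun k i => T i k) k w.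
Local Notation Tw := word_act.

Lemma word_act_linear w a h k : Tw w (a *: h + k) = a *: Tw w h + Tw w k.
Proof. by elim: w h k => //= i w IHw h k; rewrite T_lin IHw. Qed.

Definition defect (x y : H) : C := inner x y - \sum_(i <- J) inner (T i x) (T i y).

Lemma defect_psd : psd_form defect.
Proof.
split=> [a x y z|x y|x]; rewrite /defect.
- rewrite mulrBr mulr_sumr innerDl innerZl [RHS]addrACA -opprD -big_split /=.
  by congr (_ - _); apply: eq_bigr => i _; rewrite T_lin innerDl innerZl.
- rewrite rmorphB rmorph_sum; congr (_ - _); first exact: innerC.
  by apply: eq_bigr => i _; exact: innerC.
- rewrite subr_ge0 inner_norm (le_trans _ (_ : c * `|x| ^+ 2 <= _)) //.
    by under eq_bigr do rewrite inner_norm.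
  by rewrite ler_piMl // exprn_ge0.
Qed.

(** The remainder of the truncation; iterating the row bound makes it decay like [c ^+ N]. *)
Definition level_form N (h k : H) : C := \sum_(w <- level J N) inner (Tw w h) (Tw w k).

Lemma level_form_psd N : psd_form (level_form N).
Proof.
split=> [a x y z|x y|x]; rewrite /level_form.
- rewrite mulr_sumr -big_split /=; apply: eq_bigr => w _.
  by rewrite word_act_linear innerDl innerZl.
- by rewrite rmorph_sum; apply: eq_bigr => w _; exact: innerC.
- by rewrite sumr_ge0 // => w _; exact: (psd_form_ge0 inner_psd).
Qed.

Lemma level_form_le N h : level_form N h h <= c ^+ N * `|h| ^+ 2.
Proof.
elim: N h => [|N IHN] h; first by rewrite /level_form /= big_seq1 inner_norm mul1r.
rewrite /level_form big_level_recl; apply: (@le_trans _ _ (\sum_(i <- J) c ^+ N * `|T i h| ^+ 2)).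
  by apply: ler_sum => i _; exact: IHN.
by rewrite -mulr_sumr exprSr -mulrA ler_wpM2l ?exprn_ge0.
Qed.

(** Telescoping: the defect at w is the term of w minus those of its extensions by one letter, so
    only the empty word and the words of length N survive. *)
Lemma sum_defect N h k :
  \sum_(w <- words J N) defect (Tw w h) (Tw w k) = inner h k - level_form N h k.
Proof.
elim: N h k => [|N IHN] h k; first by rewrite /level_form big_nil big_seq1 subrr.
rewrite big_words_recl /level_form big_level_recl /=.
under eq_bigr do rewrite IHN.
by rewrite sumrB addrA subrK.
Qed.

Lemma tensor_form1 (F : seq (seq I)) (V : lmodType C) (B : V -> V -> C) u v : uniq F ->
  tensor_form F B (1 : bounded_op Fock) u v = \sum_(a <- F) B (u a) (v a).
Proof.
move=> uF; rewrite /tensor_form !big_seq; apply: eq_bigr => a aF.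
rewrite (bigD1_seq a) //= eqxx mul1r big1 ?addr0 // => b ba.
by rewrite eq_sym (negbTE ba) mul0r.
Qed.

Definition poisson_form N (X : bounded_op Fock) (h k : H) : C :=
  tensor_form (words J N) defect X (Tw^~ h) (Tw^~ k).

Lemma poisson_form_linear N a X Y h k :
  poisson_form N (a *: X + Y) h k = a * poisson_form N X h k + poisson_form N Y h k.
Proof.
rewrite /poisson_form /tensor_form mulr_sumr -big_split /=; apply: eq_bigr => v _.
rewrite mulr_sumr -big_split /=; apply: eq_bigr => w _.
by rewrite [LHS]mulrDl mulrA.
Qed.

Lemma poisson_form_linearl N a X h h' k :
  poisson_form N X (a *: h + h') k = a * poisson_form N X h k + poisson_form N X h' k.
Proof.
rewrite /poisson_form /tensor_form mulr_sumr -big_split /=; apply: eq_bigr => v _.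
rewrite mulr_sumr -big_split /=; apply: eq_bigr => w _.
by rewrite word_act_linear (psd_formP defect_psd); ring.
Qed.

Lemma poisson_form_linearr N a X h k k' :
  poisson_form N X h (a *: k + k') = a^* * poisson_form N X h k + poisson_form N X h k'.
Proof.
rewrite /poisson_form /tensor_form mulr_sumr -big_split /=; apply: eq_bigr => v _.
rewrite mulr_sumr -big_split /=; apply: eq_bigr => w _.
by rewrite word_act_linear (psd_formPr defect_psd); ring.
Qed.

Lemma poisson_form_cp N n (X : 'M[bounded_op Fock]_n) (f : 'I_n -> H) :
  positive_mx X -> 0 <= \sum_i \sum_j poisson_form N (X i j) (f j) (f i).
Proof. exact: (tensor_form_cp _ (fun i w => Tw w (f i)) defect_psd). Qed.

Lemma poisson_form1 N h k : poisson_form N 1 h k = inner h k - level_form N h k.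
Proof. by rewrite /poisson_form tensor_form1 ?words_uniq // sum_defect. Qed.

Lemma poisson_form1_le N h : poisson_form N 1 h h <= `|h| ^+ 2.
Proof. by rewrite poisson_form1 inner_norm gerBl (psd_form_ge0 (level_form_psd N)). Qed.

Lemma poisson_form_le N X h k : `|poisson_form N X h k| <= `|X| * `|h| * `|k|.
Proof.
rewrite -ler_sqr ?nnegrE ?mulr_ge0 // !exprMn.
apply: le_trans (tensor_form_CS _ _ _ _ defect_psd) _.
have ge0 x : 0 <= poisson_form N 1 x x.
  by rewrite /poisson_form tensor_form1 ?words_uniq // sumr_ge0 // => w _; exact: (psd_form_ge0 defect_psd).
apply: ler_pM; [by rewrite mulr_ge0 ?exprn_ge0 //; exact: ge0|exact: ge0| |exact: poisson_form1_le].
by rewrite ler_wpM2l ?exprn_ge0 //; exact: poisson_form1_le.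
Qed.

Lemma poisson_form1_near N h k :
  `|poisson_form N 1 h k - inner h k| <= c ^+ N * (`|h| * `|k|).
Proof.
rewrite poisson_form1 addrAC subrr add0r normrN.
rewrite -ler_sqr ?nnegrE ?mulr_ge0 ?exprn_ge0 // !exprMn.
apply: le_trans (psd_form_CS (level_form_psd N) _ _) _.
rewrite [X in _ <= X * _]expr2 mulrACA.
by apply: ler_pM; rewrite ?level_form_le ?(psd_form_ge0 (level_form_psd N)).
Qed.

(** Only the words i a contribute to the form of S_i X, and removing i replaces k by [T i k]. The
    two sums then differ by the words a of length exactly N. *)
Lemma poisson_form_intertwine N X i h k : i \in J ->
  `|poisson_form N.+1 (Sop i * X) h k - poisson_form N.+1 X h (T i k)| ^+ 2 <=
  `|X| ^+ 2 * `|h| ^+ 2 * (c ^+ N * `|T i k| ^+ 2).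
Proof.
(* Supported on the top level, [v] turns the difference into a tensor form, to which the
   Cauchy-Schwarz inequality applies. *)
move=> iJ; pose v a := if size a == N then Tw a (T i k) else 0.
pose g a := \sum_(b <- words J N.+1) X (ebasis b) a * defect (Tw b h) (Tw a (T i k)).
have E1 : poisson_form N.+1 (Sop i * X) h k = \sum_(a <- words J N) g a.
  rewrite /poisson_form /tensor_form big_words_recl [X in X + _]big1 ?add0r; last first.
    by move=> b _; rewrite bopME /= mul0r.
  rewrite (bigD1_seq i) //= [X in _ + X]big1 ?addr0 => [|j ji]; last first.
    rewrite big1 // => a _; rewrite big1 // => b _.
    by rewrite (negbTE ji) !mul0r.
  by apply: eq_bigr => a _; apply: eq_bigr => b _; rewrite eqxx mul1r.
have E2 : \sum_(a <- level J N) g a = tensor_form (words J N.+1) defect X (Tw^~ h) v.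
  rewrite /tensor_form big_words_recr [X in _ = X + _]big_seq [X in _ = X + _]big1 => [|a /size_words aN].
    rewrite add0r big_seq [RHS]big_seq; apply: eq_bigr => a /size_level aN.
    by apply: eq_bigr => b _; rewrite /v aN eqxx.
  by apply: big1 => b _; rewrite /v ltn_eqF // (psd_form0r defect_psd) mulr0.
rewrite E1 [X in _ - X](_ : _ = \sum_(a <- words J N.+1) g a) // big_words_recr E2.
rewrite opprD addrA subrr add0r normrN.
apply: le_trans (tensor_form_CS _ _ _ _ defect_psd) _.
have u0 : 0 <= `|X| ^+ 2 by rewrite exprn_ge0.
have v0 F w : uniq F -> 0 <= tensor_form F defect (1 : bounded_op Fock) w w.
  by move=> uF; rewrite tensor_form1 // sumr_ge0 // => a _; exact: (psd_form_ge0 defect_psd).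
have uW := words_uniq N.+1 J_uniq.
apply: ler_pM; rewrite ?v0 ?mulr_ge0 ?v0 //.
  by rewrite ler_wpM2l //; exact: poisson_form1_le.
rewrite tensor_form1 // big_words_recr [X in X + _]big_seq [X in X + _]big1 => [|a /size_words aN].
  rewrite add0r; apply: le_trans (level_form_le N _).
  rewrite big_seq [leRHS]big_seq; apply: ler_sum => a /size_level aN.
  rewrite /v aN eqxx /defect gerBl sumr_ge0 // => j _; exact: (psd_form_ge0 inner_psd).
by rewrite /v ltn_eqF // (psd_form0r defect_psd).
Qed.

End PoissonKernel.

(** * Limits of bounded functions along an ultrafilter *)

Section GeneralizedLimit.
Context {R : realType} {P : Type} (U : set_system P).
Local Notation C := R[i].
Hypothesis U_ultra : UltraFilter U.
Implicit Types (f g : P -> C).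

Definition norm_bounded f := exists K : C, forall p, `|f p| <= K.

Let UF : ProperFilter U := ultra_proper.
#[local] Existing Instance UF.

Let ucvg f (l : C) := forall e : C, 0 < e -> U [set p | `|f p - l| <= e].

Let ucvg_unique f l l' : ucvg f l -> ucvg f l' -> l = l'.
Proof.
move=> fl fl'; apply/eqP; rewrite -subr_eq0; apply/eqP/norm_le_eq0 => e e0.
have e2 : 0 < e / 2 by rewrite divr_gt0.
have [p [/= pl pl']] := filter_ex (filterI (fl _ e2) (fl' _ e2)).
rewrite [e]splitr (_ : l - l' = (f p - l') - (f p - l)); last by ring.
by rewrite (le_trans (ler_normB _ _)) // lerD.
Qed.

(** Compactness of [-K, K] gives a cluster point, and an ultrafilter converges to each of its
    cluster points. *)
Let ucvg_real (f : P -> R) (K : R) : (forall p, - K <= f p <= K) ->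
  exists l, ucvg (fun p => (f p)%:C%C) (l%:C)%C.
Proof.
move=> fK; have [l [_ fl]] : `[- K, K]%classic `&` cluster (f @ U) !=set0.
  apply: segment_compact; rewrite /fmap /=.
  rewrite (_ : _ @^-1` _ = setT); first exact: filterT.
  by apply/seteqP; split=> // p _; rewrite /= in_itv /=; exact: fK.
exists l => e e0; have eE : e = ((complex.Re e)%:C)%C by rewrite RRe_real // gtr0_real.
have e0' : 0 < complex.Re e by rewrite -ltcR -eE.
set A := (X in U X); have [//|UA] := in_ultra_setVsetC A U_ultra.
have [x [nAx lx]] := fl [set x | ~ `|(x%:C)%C - (l%:C)%C| <= e] _ UA (nbhsx_ballx l _ e0').
case: nAx; rewrite -rmorphB normc_def /= expr0n addr0 sqrtr_sqr eE lecR distrC ltW //.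
Qed.

Let ucvg_ex f : norm_bounded f -> exists l, ucvg f l.
Proof.
move=> [K fK]; have K0 (p : P) : 0 <= K by exact: le_trans (normr_ge0 _) (fK p).
have bnd (u : C -> R) : (forall z, (`|u z|)%:C%C <= `|z|) ->
    forall p, - complex.Re K <= u (f p) <= complex.Re K.
  move=> uz p; rewrite -ler_norml -lecR (le_trans (uz _)) // (le_trans (fK p)) //.
  by rewrite RRe_real // ger0_real // (K0 p).
have [l1 c1] := ucvg_real (bnd _ (@normc_ge_Re R)).
have [|l2 c2] := ucvg_real (bnd (fun z => complex.Im z) _).
  move=> z; rewrite -normrN -ReiNIm (le_trans (normc_ge_Re _)) // normrM.
  by rewrite [X in _ * X]normc_def /= expr0n expr1n add0r sqrtr1 mulr1.
exists (l1%:C + 'i * l2%:C)%C => e e0; have e2 : 0 < e / 2 by rewrite divr_gt0.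
apply: filterS (filterI (c1 _ e2) (c2 _ e2)) => p [/= h1 h2].
rewrite [f p]complexE.
rewrite opprD addrACA -mulrBr [e]splitr (le_trans (ler_normD _ _)) // lerD //.
by rewrite normrM [X in X * _](_ : _ = 1) ?mul1r // normc_def /= expr0n expr1n add0r sqrtr1.
Qed.

(** The values of [L] at unbounded functions are arbitrary, hence the boundedness premises. *)
Lemma generalized_limit : exists L : (P -> C) -> C,
  [/\ forall a f g, norm_bounded f -> norm_bounded g ->
        L (fun p => a * f p + g p) = a * L f + L g,
      forall f, norm_bounded f -> (forall p, 0 <= f p) -> 0 <= L f,
      forall f (K : C), (forall p, `|f p| <= K) -> `|L f| <= K &
      forall f (l : C), norm_bounded f ->
        (forall e : C, 0 < e -> U [set p | `|f p - l| <= e]) -> L f = l].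
Proof.
have /choice[L LP] f : exists l, norm_bounded f -> ucvg f l.
  have [fb|nfb] := pselect (norm_bounded f); last by exists 0.
  by have [l fl] := ucvg_ex fb; exists l.
have LE f l : norm_bounded f -> ucvg f l -> L f = l.
  by move=> fb; apply: ucvg_unique; exact: LP.
exists L; split=> [a f g fb gb|f fb f0|f K fK|//].
- apply: LE.
    have [[K fK] [K' gK']] := (fb, gb); exists (`|a| * K + K') => p.
    by rewrite (le_trans (ler_normD _ _)) // lerD // normrM ler_wpM2l.
  move=> e e0; have a0 : 0 < `|a| + 1 by rewrite ltr_wpDl.
  have e1 : 0 < e / 2 / (`|a| + 1) by rewrite !divr_gt0.
  apply: filterS (filterI (LP f fb _ e1) (LP g gb _ (divr_gt0 e0 (ltr0n C 2)))) => p [/= h1 h2].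
  rewrite opprD addrACA -mulrBr [e]splitr (le_trans (ler_normD _ _)) // lerD // normrM.
  apply: (@le_trans _ _ ((`|a| + 1) * `|f p - L f|)); first by rewrite ler_wpM2r // lerDl.
  by rewrite mulrC -ler_pdivlMr.
(* Since |f| = f, the number |L f| is a limit of f as well. *)
- rewrite (_ : L f = `|L f|) //; apply: (@ucvg_unique f); first exact: LP.
  move=> e e0; apply: filterS (LP f fb e e0) => p /= /(le_trans _); apply.
  by rewrite -{1}(ger0_norm (f0 p)) ler_dist_dist.
- apply/ler_addgt0Pr => e e0; have fb : norm_bounded f by exists K.
  have [p /= pe] := filter_ex (LP f fb e e0).
  rewrite (_ : L f = f p - (f p - L f)); last by ring.
  by rewrite (le_trans (ler_normB _ _)) // lerD.
Qed.

End GeneralizedLimit.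

(** This makes the filter of approximants proper. By Bernoulli's inequality d (1 + d)^N >= d + N
    d^2, so any N >= d^-2 will do. *)
Lemma exists_small_power {R : realType} (d : R[i]) : 0 < d ->
  exists N, (1 + d)^-1 ^+ N <= d.
Proof.
move=> d0; pose x := complex.Re (d ^- 2); exists (Num.bound x).
have x0 : 0 <= d ^- 2 by rewrite invr_ge0 exprn_ge0 // ltW.
have xE : (x%:C)%C = d ^- 2 by rewrite RRe_real // ger0_real.
have x0' : 0 <= x by rewrite -lecR xE.
have := ltW (archi_boundP x0'); rewrite -lecR xE.
move: (Num.bound x) => N; rewrite rmorph_nat => dN.
have d1 : 0 < 1 + d by rewrite addr_gt0.
have bernoulli : 1 + N%:R * d <= (1 + d) ^+ N.
  elim: {dN} N => [|N IHN]; first by rewrite mul0r addr0.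
  rewrite exprS (le_trans _ (ler_wpM2l (ltW d1) IHN)) // -subr_ge0.
  rewrite (_ : _ - _ = N%:R * d ^+ 2); last by rewrite -natr1; ring.
  by rewrite mulr_ge0 // exprn_ge0 // ltW.
rewrite exprVn -[leLHS]mul1r ler_pdivrMr ?exprn_gt0 //.
apply: le_trans (ler_wpM2l (ltW d0) bernoulli).
rewrite -(@ler_pM2l _ (d ^- 2)) ?invr_gt0 ?exprn_gt0 // mulr1 (le_trans dN) //.
rewrite (_ : d ^- 2 * _ = d^-1 + N%:R); last by field; rewrite gt_eqF.
by rewrite lerDr invr_ge0 ltW.
Qed.

(** * The completely positive map attached to a row contraction *)

Section PoissonTransformExistence.
Context {R : realType} {I : choiceType} {H : hilbertType R}.
Local Notation C := R[i].
Local Notation Fock := (ell2 R (seq I)).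

Context (T : I -> H -> H).
Hypothesis T_lin : forall i a h k, T i (a *: h + k) = a *: T i h + T i k.
Hypothesis T_le : forall (J : seq I) k, uniq J -> \sum_(i <- J) `|T i k| ^+ 2 <= `|k| ^+ 2.

(* The triple (J, e, N) stands for the approximant using the letters of J, the dilation
   parameter r = 1 / (1 + |e|) and the words of length at most N. *)
Let approximant : Type := ({fset I} * C * nat)%type.
Implicit Types (p : approximant) (X Y : bounded_op Fock).

Let r p : C := (1 + `|p.1.2|)^-1.

Let r_gt0 p : 0 < r p.
Proof. by rewrite invr_gt0 ltr_wpDr. Qed.

Let r_le1 p : r p <= 1.
Proof. by rewrite invf_le1 ?ltr_wpDr // lerDl. Qed.

Let Tr p i k := r p *: T i k.

Let Tr_lin p i a h k : Tr p i (a *: h + k) = a *: Tr p i h + Tr p i k.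
Proof. by rewrite /Tr T_lin scalerDr !scalerA mulrC. Qed.

Let c p : C := r p ^+ 2.
Let c_ge0 p : 0 <= c p. Proof. by rewrite exprn_ge0 // ltW. Qed.
Let c_le1 p : c p <= 1. Proof. by rewrite exprn_ile1 // ltW. Qed.

Let Tr_le p (J : seq I) k : uniq J -> \sum_(i <- J) `|Tr p i k| ^+ 2 <= c p * `|k| ^+ 2.
Proof.
move=> uJ; have -> : \sum_(i <- J) `|Tr p i k| ^+ 2 = c p * \sum_(i <- J) `|T i k| ^+ 2.
  rewrite mulr_sumr; apply: eq_bigr => i _.
  by rewrite normrZ exprMn ger0_norm // ltW.
by rewrite ler_wpM2l // T_le.
Qed.

(** Smallness is imposed on r^N rather than on 1 / N: the length needed depends on how close r is to
    1. *)
Let F : set_system approximant := filter_from [set q : {fset I} * C | 0 < q.2]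
  (fun q => [set p | [/\ (q.1 `<=` p.1.1)%fset, 1 - r p <= q.2 & r p ^+ p.2 <= q.2]]).

Let F_proper : ProperFilter F.
Proof.
apply: filter_from_proper => [|[J d] /= d0]; last first.
  have [N dN] := exists_small_power d0; exists (J, d, N).
  have nd : `|d| = d by rewrite ger0_norm // ltW.
  split; rewrite /r /= ?nd //.
  have d1 : 0 < 1 + d by rewrite addr_gt0.
  rewrite (_ : 1 - _ = d / (1 + d)); last by field; rewrite gt_eqF.
  by rewrite ler_pdivrMr // ler_peMr ?(ltW d0) // lerDl (ltW d0).
apply: filter_from_filter; first by exists (fset0, 1) => /=.
move=> [J d] [J' d'] /= d0 d0'; have dd : 0 < d + d' by rewrite addr_gt0.
exists ((J `|` J')%fset, d * d' / (d + d')) => [|p [/= JJ p1 p2]].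
  by rewrite /= divr_gt0 ?mulr_gt0.
have [h h'] : d * d' / (d + d') <= d /\ d * d' / (d + d') <= d'.
  rewrite !(ler_pdivrMr _ _ dd) !mulrDr lerDr (mulrC d d') lerDl.
  by rewrite !mulr_ge0 ?(ltW d0) ?(ltW d0').
move: JJ; rewrite fsubUset => /andP[JJ JJ'].
by split; split=> //=; [exact: le_trans p1 h|exact: le_trans p2 h
  |exact: le_trans p1 h'|exact: le_trans p2 h'].
Qed.

Let form p X h k := poisson_form (Tr p) (enum_fset p.1.1) p.2.+1 X h k.

Let TrJ_le p k := Tr_le p k (fset_uniq p.1.1).

Let form_le X h k p : `|form p X h k| <= `|X| * `|h| * `|k|.
Proof. exact: (poisson_form_le (Tr_lin p) (fset_uniq _) (c_le1 p) (TrJ_le p)). Qed.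

Let form1_near h k (e : C) : 0 < e -> F [set p | `|form p 1 h k - inner h k| <= e].
Proof.
move=> e0; have hk : 0 < `|h| * `|k| + 1 by rewrite ltr_wpDl ?mulr_ge0.
exists (fset0, e / (`|h| * `|k| + 1)) => [|p [_ _ /= pN]] /=; first by rewrite divr_gt0.
apply: le_trans (poisson_form1_near (Tr_lin p) (fset_uniq _) (c_ge0 p) (TrJ_le p) _ _ _) _.
apply: (@le_trans _ _ (r p ^+ p.2 * (`|h| * `|k| + 1))); last by rewrite -ler_pdivlMr.
apply: ler_pM; rewrite ?exprn_ge0 ?mulr_ge0 ?lerDl ?c_ge0 ?(ltW (r_gt0 p)) //.
(* c^(N+1) = r^(2N+2) is at most r^N, as r <= 1. *)
rewrite /c -exprM ler_wiXn2l ?(ltW (r_gt0 p)) //.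
by rewrite mul2n -addnn leqW // leq_addr.
Qed.

(** There are two errors, at most r^N K from the truncation and (1 - r) K from replacing r T_i by
    T_i; the choice of [d] makes each at most e / 2. *)
Let intertwine_near X i h k (e : C) : 0 < e ->
  F [set p | `|form p (Sop i * X) h k - form p X h (T i k)| <= e].
Proof.
move=> e0; set K := `|X| * `|h| * `|k|.
have K0 : 0 <= K by rewrite !mulr_ge0.
have K1 : 0 < 2 * (K + 1) by rewrite mulr_gt0 // ltr_wpDl.
pose d := e / (2 * (K + 1)); have d0 : 0 < d by rewrite divr_gt0.
exists ([fset i]%fset, d) => //= p [/= /fsubsetP/(_ i (fset11 i)) ip p1 p2].
have Tk x : `|T i x| <= `|x|.
  by rewrite -ler_sqr ?nnegrE //; have := T_le x (isT : uniq [:: i]); rewrite big_seq1.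
have rp : 0 <= r p by rewrite ltW.
have Trk : `|Tr p i k| <= `|k|.
  by rewrite normrZ ger0_norm // (le_trans _ (Tk k)) // ler_piMl.
have Kd a : 0 <= a -> a <= d -> a * K <= e / 2.
  move=> a0 ad; apply: (@le_trans _ _ (d * (K + 1))).
    by apply: ler_pM => //; rewrite lerDl.
  rewrite le_eqVlt; apply/orP; left; apply/eqP; rewrite /d; field.
  by rewrite gt_eqF // ltr_wpDl.
have h1 : `|form p (Sop i * X) h k - form p X h (Tr p i k)| <= r p ^+ p.2 * K.
  rewrite -ler_sqr ?nnegrE ?mulr_ge0 ?exprn_ge0 //.
  apply: le_trans (poisson_form_intertwine (Tr_lin p) (fset_uniq _) (c_ge0 p) (c_le1 p)
    (TrJ_le p) _ _ _ _ ip) _.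
  rewrite (_ : (_ * K) ^+ 2 = `|X| ^+ 2 * `|h| ^+ 2 * (c p ^+ p.2 * `|k| ^+ 2)).
    by rewrite !ler_wpM2l ?mulr_ge0 ?exprn_ge0 ?c_ge0 // ler_sqr ?nnegrE.
  by rewrite /c exprAC /K; ring.
have h2 : `|form p X h (Tr p i k) - form p X h (T i k)| <= (1 - r p) * K.
  have -> : form p X h (Tr p i k) = r p * form p X h (T i k).
    rewrite /Tr -[_ *: _]addr0 /form.
    rewrite (poisson_form_linearr (Tr_lin p) (c_le1 p) (TrJ_le p)) conj_Creal ?ger0_real //.
    have := form_le X h 0 p; rewrite normr0 mulr0 normr_le0 => /eqP; rewrite /form => ->.
    by rewrite addr0.
  rewrite -[X in _ - X]mul1r -mulrBl normrM distrC.
  have rp1 : 0 <= 1 - r p by rewrite subr_ge0.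
  rewrite (ger0_norm rp1).
  apply: ler_wpM2l; rewrite ?subr_ge0 //; apply: le_trans (form_le _ _ _ _) _.
  by rewrite ler_wpM2l ?mulr_ge0.
rewrite -(subrK (form p X h (Tr p i k)) (form p (Sop i * X) h k)) -addrA.
rewrite (le_trans (ler_normD _ _)) // [e]splitr lerD //.
  by apply: le_trans h1 (Kd _ _ _); rewrite ?exprn_ge0.
by apply: le_trans h2 (Kd _ _ _); rewrite ?subr_ge0 // lerBlDr addrC -lerBlDr.
Qed.

(* The last identity holds for all bounded X, not only for X in the C*-algebra, so no
   density of the span of the S_a S_b^* is needed to get multiplicativity. *)
Lemma poisson_map_exists : exists mu : bounded_op Fock -> bounded_op H,
  [/\ linear mu, mu 1 = 1, forall X, `|mu X| <= `|X|,
      forall n (X : 'M[bounded_op Fock]_n), positive_mx X -> positive_mx (map_mx mu X) &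
      forall i X h k, inner (mu (Sop i * X) h) k = inner (mu X h) (T i k)].
Proof.
have [U [U_ultra FU]] := ultraFilterLemma F_proper.
have [L [L_lin L_ge0 L_norm L_near]] := generalized_limit (R := R) U_ultra.
have fb X h k : norm_bounded (fun p => form p X h k).
  by exists (`|X| * `|h| * `|k|); exact: form_le.
pose b X h k := L (fun p => form p X h k).
have b_linear a X Y h k : b (a *: X + Y) h k = a * b X h k + b Y h k.
  rewrite /b -L_lin //; congr L; apply/funext => p; exact: poisson_form_linear.
have b_linearl a X h h' k : b X (a *: h + h') k = a * b X h k + b X h' k.
  rewrite /b -L_lin //; congr L; apply/funext => p.
  exact: (poisson_form_linearl (Tr_lin p) (c_le1 p) (TrJ_le p)).
have b_linearr a X h k k' : b X h (a *: k + k') = a^* * b X h k + b X h k'.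
  rewrite /b -L_lin //; congr L; apply/funext => p.
  exact: (poisson_form_linearr (Tr_lin p) (c_le1 p) (TrJ_le p)).
have b_le X h k : `|b X h k| <= `|X| * `|h| * `|k|.
  by apply: L_norm => p; exact: form_le.
(* The limit form is sesquilinear and bounded, hence given by an operator. It is conjugated below
   because [riesz] expects a functional linear in k. *)
have /choice[mu muE] X : exists A : bounded_op H, forall h k, inner (A h) k = b X h k.
  have /choice[A AE] h : exists w, forall k, inner w k = b X h k.
    have [||x|w wE] := riesz (H := H) (f := fun k => (b X h k)^*) (K := `|X| * `|h|).
    - by rewrite mulr_ge0.
    - by move=> a x y; rewrite b_linearr rmorphD rmorphM /= conjCK.
    - by rewrite norm_conjC.
    - by exists w => k; rewrite innerC wE conjCK.
  have Ab : A \in bounded_op_pred H.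
    apply/asboolP; split=> [a x y|].
      by apply: inner_inj => k; rewrite innerDl innerZl !AE b_linearl.
    exists `|X| => h; have [->|Ah0] := eqVneq (A h) 0; first by rewrite normr0 mulr_ge0.
    rewrite -(@ler_pM2r _ `|A h|) ?normr_gt0 // -expr2 -inner_norm AE.
    by rewrite -[leLHS]ger0_norm ?b_le // -AE inner_norm exprn_ge0.
  by exists (BoundedOp Ab).
have mu_le X h : `|mu X h| <= `|X| * `|h|.
  have [->|Ah0] := eqVneq (mu X h) 0; first by rewrite normr0 mulr_ge0.
  rewrite -(@ler_pM2r _ `|mu X h|) ?normr_gt0 // -expr2 -inner_norm.
  rewrite -[leLHS]ger0_norm; first by rewrite muE b_le.
  by rewrite inner_norm exprn_ge0.
exists mu; split=> [a X Y||X|n X X0 f|i X h k].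
- apply: bopP => h; apply: inner_inj => k.
  by rewrite bopDE bopZE innerDl innerZl !muE b_linear.
- apply: bopP => h; apply: inner_inj => k; rewrite muE bop1E; apply: L_near => // e e0.
  exact: FU (form1_near h k e0).
- by apply: opnorm_le => h h1; rewrite (le_trans (mu_le X h)) // ler_piMr.
- under eq_bigr do under eq_bigr do rewrite mxE muE.
  have L0 : L (fun=> 0) = 0.
    apply: L_near => [|e e0]; first by exists 0 => p; rewrite normr0.
    by apply: FU; exists (fset0, e) => //= p _; rewrite subrr normr0 ltW.
  (* Boundedness is carried through the induction, [L] being linear on bounded functions only. *)
  have L_sum (J : Type) (s : seq J) (g : J -> approximant -> C) :
      (forall j, norm_bounded (g j)) ->
      norm_bounded (fun p => \sum_(j <- s) g j p) /\
      \sum_(j <- s) L (g j) = L (fun p => \sum_(j <- s) g j p).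
    move=> gb; elim: s => [|j s [sb IHs]].
      rewrite big_nil; split; first by exists 0 => p; rewrite big_nil normr0.
      by rewrite -[LHS]L0; congr L; apply/funext => p; rewrite big_nil.
    split.
      have [[K gK] [K' sK]] := (gb j, sb); exists (K + K') => p.
      by rewrite big_cons (le_trans (ler_normD _ _)) // lerD.
    rewrite big_cons IHs -[L (g j)]mul1r -L_lin //; congr L; apply/funext => p.
    by rewrite big_cons mul1r.
  rewrite pair_big /=.
  have [gb ->] := L_sum _ (index_enum _) (fun (q : 'I_n * 'I_n) p =>
     form p (X q.1 q.2) (f q.2) (f q.1)) (fun q => fb _ _ _).
  apply: L_ge0 => // p; rewrite -(pair_big xpredT xpredT
     (fun i j => form p (X i j) (f j) (f i))) /=.
  exact: (poisson_form_cp (Tr_lin p) (c_le1 p) (TrJ_le p)).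
- rewrite !muE; apply/eqP; rewrite -subr_eq0 addrC -mulN1r /b -L_lin //; apply/eqP.
  apply: L_near => [|e e0].
    have [[K fK] [K' fK']] := (fb X h (T i k), fb (Sop i * X) h k); exists (K + K') => p.
    by rewrite mulN1r (le_trans (ler_normD _ _)) // normrN lerD.
  apply: filterS (FU _ (intertwine_near X i h k e0)) => p /=.
  by rewrite mulN1r addrC subr0.
Qed.

End PoissonTransformExistence.

(** * Kernel positivity for weighted lists of points *)

Lemma sum_fibers {X : choiceType} {S : pzSemiRingType} (s : seq (S * X)) (A : {fset X})
    (g : X -> S) : (forall p, p \in s -> p.2 \in A) ->
  \sum_(p <- s) p.1 * g p.2 = \sum_(x <- A) (\sum_(p <- s | p.2 == x) p.1) * g x.
Proof.
move=> sA; under [RHS]eq_bigr do rewrite mulr_suml.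
rewrite (exchange_big_dep xpredT) //= big_seq [RHS]big_seq; apply: eq_bigr => p ps.
rewrite -big_filter (eq_filter (a2 := pred1 p.2)); last by move=> x; rewrite /= eq_sym.
by rewrite filter_pred1_uniq ?fset_uniq ?sA // big_seq1.
Qed.

(** Adding up the weights of equal points turns the list into one finitely supported function. Lists
    with repetitions are what concatenating elements of the relations G_i produces. *)
Lemma psd_kernel_seq {R : realType} {X : choiceType} (K : X -> X -> R[i]) (s : seq (R[i] * X)) :
  psd_kernel K -> 0 <= \sum_(p <- s) \sum_(q <- s) K p.2 q.2 * q.1 * p.1^*.
Proof.
pose A := seq_fset tt [seq p.2 | p <- s].
have sA p : p \in s -> p.2 \in A by move=> ps; rewrite seq_fsetE map_f.
pose g x := \sum_(p <- s | p.2 == x) p.1.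
pose h := [fsfun x in A => g x | 0] : {fsfun X -> R[i] with 0}.
move=> /(_ h).
have hA x : x \in A -> h x = g x by move=> xA; rewrite fsfunE xA.
have hN x : x \notin finsupp h -> h x = 0 by move=> xh; rewrite fsfun_dflt.
have hsub : (finsupp h `<=` A)%fset.
  by apply/fsubsetP => x; apply: contraLR => xA; rewrite mem_finsupp negbK fsfunE (negbTE xA).
rewrite (big_fset_incl _ hsub); last first.
  by move=> x _ /hN h0; rewrite big1 // => y _; rewrite h0 rmorph0 mulr0.
under eq_bigr => x _.
  rewrite (big_fset_incl _ hsub); last by move=> y _ /hN ->; rewrite mulr0 mul0r.
over.
suff -> : \sum_(p <- s) \sum_(q <- s) K p.2 q.2 * q.1 * p.1^* =
  \sum_(x <- A) \sum_(y <- A) K x y * h y * (h x)^* by [].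
transitivity (\sum_(p <- s) (p.1 * (\sum_(y <- A) g y * K p.2 y)^*)^*).
  apply: eq_bigr => p _; rewrite rmorphM /= conjCK -(sum_fibers (K p.2) sA) mulr_sumr.
  by apply: eq_bigr => q _; rewrite mulrC (mulrC q.1).
rewrite -rmorph_sum /= (sum_fibers (fun x => (\sum_(y <- A) g y * K x y)^*) sA).
rewrite rmorph_sum big_seq [RHS]big_seq; apply: eq_bigr => x xA.
rewrite rmorphM /= conjCK mulr_sumr big_seq [RHS]big_seq; apply: eq_bigr => y yA.
by rewrite !hA // mulrC (mulrC (g y)).
Qed.

Lemma linear_bundle {R : pzRingType} {U V : lmodType R} (f : U -> V) : linear f ->
  exists g : {linear U -> V}, g =1 f.
Proof.
move=> f_lin; pose fL := GRing.isLinear.Build R U V *:%R f f_lin.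
by pose g : {linear U -> V} := HB.pack f fL; exists g.
Qed.

Section BoundedOpAlgebra.
Context {R : realType} {V : normedModType R[i]}.
Implicit Types (A B : bounded_op V).

Lemma bop_scaleAl a A B : (a *: A) * B = a *: (A * B).
Proof. exact: bopP. Qed.

Lemma opnormM A B : `|A * B| <= `|A| * `|B|.
Proof.
apply: opnorm_le => x x1; rewrite bopME (le_trans (opnormP _ _)) //.
by rewrite ler_wpM2l ?opnorm_ge0 // opnorm_ub.
Qed.

End BoundedOpAlgebra.

(** * From the kernel inequality to a Poisson transform *)

Section KernelToTransform.
Context {R : realType} {I : choiceType} {H : hilbertType R}.
Context (Sigma : set (seq I)) (M : seq I -> H).
Hypothesis Sigma_adm : admissible Sigma.
Hypothesis K_le : kernel_le (K3 Sigma M) (K4 Sigma M).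
Local Notation C := R[i].
Local Notation Fock := (ell2 R (seq I)).

(* Pairs (sum a_s M(s), sum a_s M(g_i s)), over the words s with g_i s in Sigma. *)
Let G i : set (H * H) := [set xy | exists s : seq (C * Lambda Sigma),
  [/\ forall p, p \in s -> (val p.2).1 = [:: i],
      xy.1 = \sum_(p <- s) p.1 *: M (val p.2).2 &
      xy.2 = \sum_(p <- s) p.1 *: M ((val p.2).1 ++ (val p.2).2)]].

Let G0 i : G i (0, 0).
Proof. by exists [::]; rewrite !big_nil. Qed.

Let G_linear i a p q : G i p -> G i q -> G i (a *: p.1 + q.1, a *: p.2 + q.2).
Proof.
move=> [s [si -> ->]] [t [ti -> ->]]; exists ([seq (a * p.1, p.2) | p <- s] ++ t).
split=> [x||] /=.
- by rewrite mem_cat => /orP[/mapP[y ys ->]|]; [exact: si ys|exact: ti].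
- by rewrite big_cat big_map scaler_sumr; congr (_ + _); apply: eq_bigr => x _; rewrite scalerA.
- by rewrite big_cat big_map scaler_sumr; congr (_ + _); apply: eq_bigr => x _; rewrite scalerA.
Qed.

(** Two one-letter words are comparable only when equal, so on such pairs [K4] is block diagonal
    over the letters. *)
Lemma K4_letters (x y : Lambda Sigma) i j : (val x).1 = [:: i] -> (val y).1 = [:: j] ->
  K4 Sigma M x y = if i == j then inner (M (val y).2) (M (val x).2) else 0.
Proof.
rewrite /K4; case: (val x) => _ a /= ->; case: (val y) => _ b /= -> /=.
by rewrite /word_lt /= !andbT (eq_sym j i); case: eqVneq.
Qed.

(** Evaluated at the concatenated coefficients, [K3] gives |sum y_i|^2 and the block diagonal [K4]
    gives sum |x_i|^2. *)
Let G_contraction (J : seq I) (x y : I -> H) : uniq J -> (forall i, G i (x i, y i)) ->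
  `|\sum_(i <- J) y i| ^+ 2 <= \sum_(i <- J) `|x i| ^+ 2.
Proof.
move=> uJ /choice[s sP].
have := psd_kernel_seq (flatten [seq s i | i <- J]) K_le.
set r := flatten _.
have rE (V : nmodType) (F : C * Lambda Sigma -> V) :
    \sum_(p <- r) F p = \sum_(i <- J) \sum_(p <- s i) F p.
  by rewrite big_flatten big_map.
have yE : \sum_(i <- J) y i = \sum_(p <- r) p.1 *: M ((val p.2).1 ++ (val p.2).2).
  by rewrite rE; apply: eq_bigr => i _; have [_ _ <-] := sP i.
have K3E : `|\sum_(i <- J) y i| ^+ 2 =
    \sum_(p <- r) \sum_(q <- r) K3 Sigma M p.2 q.2 * q.1 * p.1^*.
  rewrite -inner_norm yE inner_sumr; apply: eq_bigr => p _.
  rewrite innerZr inner_suml mulr_sumr; apply: eq_bigr => q _.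
  rewrite innerZl /K3; case: (val p.2) => a b; case: (val q.2) => a' b' /=.
  by ring.
have K4E : \sum_(i <- J) `|x i| ^+ 2 =
    \sum_(p <- r) \sum_(q <- r) K4 Sigma M p.2 q.2 * q.1 * p.1^*.
  rewrite rE big_seq [RHS]big_seq; apply: eq_bigr => i iJ.
  have [si /= xE _] := sP i; rewrite -inner_norm {2}xE inner_sumr.
  rewrite big_seq [RHS]big_seq; apply: eq_bigr => p ps.
  rewrite innerZr rE (bigD1_seq i) //= [X in _ + X]big1 ?addr0 => [|j ji]; last first.
    rewrite big_seq big1 // => q qs; have [sj _ _] := sP j.
    by rewrite (K4_letters (si _ ps) (sj _ qs)) eq_sym (negbTE ji) !mul0r.
  rewrite xE inner_suml mulr_sumr big_seq [RHS]big_seq; apply: eq_bigr => q qs.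
  by rewrite innerZl (K4_letters (si _ ps) (si _ qs)) eqxx /=; ring.
under eq_bigr do under eq_bigr do rewrite !mulrBl.
under eq_bigr do rewrite sumrB.
by rewrite sumrB -K3E -K4E subr_ge0.
Qed.

Lemma transform_of_kernel_le :
  exists2 mu : {linear cstar R I -> bounded_op H}, poisson_transform mu &
    forall p : {fsfun seq I -> R[i] with 0}, (forall w, w \in finsupp p -> Sigma w) ->
      poly_sum M p = mu (poly_sum (fun w => \prod_(i <- w) cstarS i) p) (M [::]).
Proof.
have [T [T_lin T_le TG]] := row_adjoint G0 G_linear G_contraction.
have [mu [mu_lin mu1 mu_le mu_cp muS]] := poisson_map_exists T_lin T_le.
have mulin a X Y : mu (a *: X + Y) = a *: mu X + mu Y by exact: mu_lin.
have muB X Y : mu (X - Y) = mu X - mu Y.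
  by rewrite addrC -scaleN1r mulin scaleN1r addrC.
(* Left multiplicativity passes to products, linear combinations and norm limits, so it is enough to
   have it on the generators. *)
pose D : set (bounded_op Fock) := [set A | forall X, mu (A * X) = mu A * mu X].
have DS i : D (Sop i).
  move=> X; apply: bopP => h; apply: inner_inj => k.
  by rewrite bopME muS -[Sop i]mulr1 muS mu1.
have D_alg : closed_unital_subalgebra D.
  split.
  - apply/closure_id/seteqP; split; first exact: subset_closure.
    move=> A cA X; apply/eqP; rewrite -subr_eq0; apply/eqP/norm_le_eq0 => e e0.
    have X1 : 0 < 2 * `|X| + 1 by rewrite ltr_wpDl ?mulr_ge0.
    have [A' [DA']] := cA _ (nbhsx_ballx A _ (divr_gt0 e0 X1)).
    rewrite -ball_normE /= => /ltW AA'.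
    (* As A' is multiplicative, the failure of A equals that of A - A', which is at most 2 |A - A'|
       |X|. *)
    rewrite (_ : _ - _ = mu ((A - A') * X) - mu (A - A') * mu X); last first.
      by rewrite mulrBl !muB mulrBl DA' opprB addrA subrK.
    rewrite (le_trans (ler_normB _ _)) //.
    apply: (@le_trans _ _ (`|A - A'| * (2 * `|X| + 1))); last by rewrite -ler_pdivlMr.
    rewrite mulrDr mulr1 ler_wpDr // mulrCA mulr_natl mulr2n lerD //.
      exact: le_trans (mu_le _) (opnormM _ _).
    by apply: le_trans (opnormM _ _) (ler_pM _ _ (mu_le _) (mu_le _)).
  - by move=> X; rewrite mul1r mu1 mul1r.
  - by move=> a A B DA DB X; rewrite mulrDl !bop_scaleAl !mulin DA DB mulrDl bop_scaleAl.
  - by move=> A B DA DB X; rewrite -mulrA !DA DB mulrA.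
have [nu nuE] : exists nu : {linear cstar R I -> bounded_op H}, nu =1 mu \o (@cstar_op R I).
  by apply: linear_bundle => a x y; exact: mu_lin.
exists nu.
  split; first by rewrite nuE.
  - move=> k X X0; rewrite (_ : map_mx nu X = map_mx mu (map_mx (@cstar_op R I) X)).
      exact: mu_cp.
    by apply/matrixP => i j; rewrite !mxE nuE.
  - move=> A X DA _; rewrite !nuE; apply: (DA D) => //.
    by split=> // _ [i _ <-].
move=> p pS.
(* Induction on w: the image of S_i S_w at [M [::]] pairs with k as M(w) does with T_i k, that is,
   as M(i w) does, because (M(w), M(i w)) lies in G_i. *)
have nu_word w : Sigma w -> nu (\prod_(i <- w) cstarS i) (M [::]) = M w.
  elim: w => [|i w IHw] Sw; first by rewrite big_nil nuE /= mu1.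
  have {}IHw := IHw (Sigma_adm (alpha := [:: i]) Sw).
  rewrite big_cons nuE /=; apply: inner_inj => k.
  rewrite muS.
  move: IHw; rewrite nuE /= => ->; apply: TG.
  have Sw' : ([:: i], w) \in Lambda Sigma by rewrite inE.
  exists [:: (1, exist _ ([:: i], w) Sw' : Lambda Sigma)].
  by rewrite !big_seq1 !scale1r; split => // q; rewrite inE => /eqP ->.
rewrite /poly_sum linear_sum.
have evalE (s : seq (seq I)) (F : seq I -> bounded_op H) (x : H) :
    (\sum_(w <- s) F w) x = \sum_(w <- s) F w x.
  by elim: s => [|w s IHs]; rewrite ?big_nil // !big_cons bopDE IHs.
rewrite evalE big_seq [RHS]big_seq; apply: eq_bigr => w /pS Sw.
by rewrite linearZ bopZE nu_word.
Qed.

End KernelToTransform.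

(** The first condition compares imaginary parts, the second real parts. *)
Lemma real_sum_conj {R : realType} (u v : R[i]) :
  u + v \is Num.real -> 'i * (u - v) \is Num.real -> v = u^*.
Proof.
rewrite !CrealE rmorphM !(rmorphD, rmorphN) /= conjCi => /eqP h1.
rewrite mulNr -mulrN => /eqP /(mulfI (neq0Ci _)) h2.
have h3 : 2 * u^* = 2 * v.
  rewrite (_ : 2 * u^* = (u^* + v^*) - - (u^* - v^*)); last by ring.
  by rewrite h1 h2; ring.
have n2 : (2 : R[i]) != 0 by rewrite pnatr_eq0.
by rewrite (mulfI n2 h3).
Qed.

(** * Adjoints and the Schwarz inequality for unital completely positive maps *)

Section CompletelyPositive.
Context {R : realType} {I : choiceType} {H : hilbertType R}.
Context (mu : {linear cstar R I -> bounded_op H}).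
Hypothesis mu1 : mu 1 = 1.
Hypothesis mu_cp : completely_positive mu.

Lemma gram_mx_positive k (A B : 'I_k -> cstar R I) : (forall i, adjoint (A i) (B i)) ->
  positive_mx (map_mx (@cstar_op R I) (\matrix_(i, j) (B i * A j))).
Proof.
move=> AB f; have -> : \sum_i \sum_j inner (map_mx (@cstar_op R I) (\matrix_(i, j) (B i * A j)) i j (f j)) (f i)
   = inner (\sum_j A j (f j)) (\sum_i A i (f i)).
  rewrite inner_sumr; apply: eq_bigr => i _; rewrite inner_suml; apply: eq_bigr => j _.
  by rewrite !mxE innerC [RHS]innerC AB.
exact: (psd_form_ge0 inner_psd).
Qed.

Lemma gram_sum_ge0 k (A B : 'I_k -> cstar R I) (f : 'I_k -> H) :
  (forall i, adjoint (A i) (B i)) ->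
  0 <= \sum_i \sum_j inner (mu (B i * A j) (f j)) (f i).
Proof.
move=> AB; have := mu_cp (gram_mx_positive AB) f.
by congr (0 <= _); apply: eq_bigr => i _; apply: eq_bigr => j _; rewrite !mxE.
Qed.

(** Positivity for the pair (1, A) at the vectors (x, z) and (0, z) makes <mu(A) z, x> + <mu(B) x,
    z> real. Taking z = y and z = i y shows that <mu(A) y, x> and <mu(B) x, y> are conjugate. *)
Lemma cp_adjoint (A B : cstar R I) x y : adjoint A B ->
  inner (mu B x) y = inner x (mu A y).
Proof.
move=> AB; pose A2 (i : 'I_2) := if i == 0 then 1 else A.
pose B2 (i : 'I_2) := if i == 0 then 1 else B.
have AB2 i : adjoint (A2 i) (B2 i) by rewrite /A2 /B2; case: ifP.
have real_sum z : inner (mu A z) x + inner (mu B x) z \is Num.real.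
  have := gram_sum_ge0 (fun i : 'I_2 => if i == 0 then x else z) AB2.
  have := gram_sum_ge0 (fun i : 'I_2 => if i == 0 then 0 else z) AB2.
  rewrite !big_ord_recl !big_ord0 /= /A2 /B2 /= !mul1r !mulr1 mu1 !bop1E.
  rewrite !linear0 ?inner0l ?inner0r !addr0 ?add0r => /ger0_real h1 /ger0_real h2.
  have h3 : inner x x \is Num.real by rewrite ger0_real // (psd_form_ge0 inner_psd).
  rewrite (_ : _ + _ = inner x x + inner (mu A z) x + (inner (mu B x) z + inner (mu (B * A) z) z) - (inner x x + inner (mu (B * A) z) z)); last by ring.
  by rewrite rpredB // rpredD.
rewrite [RHS]innerC; apply: real_sum_conj => //.
have := real_sum ('i *: y).
by rewrite linearZ /= innerZl innerZr conjCi mulNr -mulrBr.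
Qed.

(** Positivity is applied to 1 and the A_j at the vectors -S and f_j, with S = sum mu(A_j) f_j: the
    corner gives |S|^2 and each of the two borders -|S|^2. *)
Lemma cp_schwarz k (A B : 'I_k -> cstar R I) (f : 'I_k -> H) :
  (forall i, adjoint (A i) (B i)) ->
  `|\sum_j mu (A j) (f j)| ^+ 2 <= \sum_i \sum_j inner (mu (B i * A j) (f j)) (f i).
Proof.
move=> AB; pose A' i := if unlift ord0 i is Some j then A j else 1.
pose B' i := if unlift ord0 i is Some j then B j else 1.
pose S := \sum_j mu (A j) (f j).
pose f' i := if unlift ord0 i is Some j then f j else - S.
have AB' i : adjoint (A' i) (B' i) by rewrite /A' /B'; case: unliftP.
have := gram_sum_ge0 f' AB'; rewrite big_ord_recl !(big_ord_recl k) /A' /B' /f' !unlift_none.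
under eq_bigr do rewrite liftK mul1r.
under [X in _ + X]eq_bigr do rewrite big_ord_recl unlift_none liftK mulr1.
under [X in _ + X]eq_bigr do under eq_bigr do rewrite liftK.
rewrite mul1r mu1 bop1E big_split /= -inner_suml -/S.
have -> : \sum_i inner (mu (B i) (- S)) (f i) = inner (- S) S.
  by rewrite /S [in RHS]inner_sumr; apply: eq_bigr => i _; rewrite (cp_adjoint _ _ (AB i)).
rewrite !innerNl !innerNr inner_norm opprK subrr add0r addrC.
by rewrite subr_ge0.
Qed.

End CompletelyPositive.

(** * Words in the creation operators and their adjoints *)

Section WordOperators.
Context {R : realType} {I : choiceType}.
Local Notation Fock := (ell2 R (seq I)).

Lemma cstarB_subproof (i : I) : backward i \in cstar_pred R I.
Proof.
apply/asboolP => D [[_ D_star] DS]; apply: D_star (backward_adjoint i) _.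
by apply: DS; exists i.
Qed.

Definition cstarB (i : I) : cstar R I := Cstar (cstarB_subproof i).

Definition Sword (w : seq I) : cstar R I := \prod_(i <- w) cstarS i.
(** Taking adjoints reverses products, hence the reversed word. *)
Definition Bword (w : seq I) : cstar R I := \prod_(i <- rev w) cstarB i.

Lemma Sword_cons i w : Sword (i :: w) = cstarS i * Sword w.
Proof. by rewrite /Sword big_cons. Qed.

Lemma Sword_cat v w : Sword (v ++ w) = Sword v * Sword w.
Proof. by rewrite /Sword big_cat. Qed.

Lemma Bword_cons i w : Bword (i :: w) = Bword w * cstarB i.
Proof. by rewrite /Bword rev_cons -cats1 big_cat /= big_seq1. Qed.

Lemma Bword0 : Bword [::] = 1. Proof. by rewrite /Bword big_nil. Qed.
Lemma Sword0 : Sword [::] = 1. Proof. by rewrite /Sword big_nil. Qed.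

Lemma adjoint_word w : adjoint (Sword w) (Bword w).
Proof.
elim: w => [|i w IHw] x y; first by rewrite Bword0 Sword0.
rewrite Bword_cons Sword_cons.
rewrite [LHS](backward_adjoint i (Sword w x) y).
exact: IHw.
Qed.

Lemma cstarBS i j : cstarB i * cstarS j = (i == j)%:R.
Proof.
have [->|ij] := eqVneq i j; apply: val_inj; first exact: backwardK.
apply: bopP => psi; apply: ell2P => w /=.
by rewrite (negbTE ij) mul0r.
Qed.

(** Equal leading letters cancel and distinct ones give 0, since S_i^* S_j is 1 or 0; the cases are
    exactly those of [K4]. *)
Lemma BwordSword v w : Bword v * Sword w =
  if prefix v w then Sword (word_quot w v)
  else if word_lt w v then Bword (word_quot v w) else 0.
Proof.
rewrite /word_quot /word_lt.
elim: v w => [|i v IHv] [|j w] /=; rewrite ?Bword0 ?Sword0 ?mul1r ?mulr1 //.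
rewrite Bword_cons Sword_cons mulrA -(mulrA _ (cstarB i)) cstarBS eqseq_cons.
rewrite (eq_sym j); have [_|_] := eqVneq i j; first by rewrite mulr1 IHv.
by rewrite mulr0 mul0r.
Qed.

Lemma disc_algebra_word w : disc_algebra (Sword w).
Proof.
move=> D [[_ D1 _ DM] DS]; elim: w => [|i w IHw]; first by rewrite Sword0.
by rewrite Sword_cons; apply: DM IHw; apply: DS; exists i.
Qed.

Lemma disc_disc_star_word w : disc_disc_star (Sword w).
Proof.
exists (Sword w), 1, 1; split; first exact: disc_algebra_word.
- by have := @disc_algebra_word [::]; rewrite Sword0.
- by [].
- by rewrite mulr1.
Qed.

End WordOperators.

(** * From a Poisson transform to the kernel inequality *)

Lemma kernel_le_of_transform {R : realType} {I : choiceType} {H : hilbertType R}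
    (Sigma : set (seq I)) (M : seq I -> H) (mu : {linear cstar R I -> bounded_op H}) :
  admissible Sigma -> poisson_transform mu ->
  (forall p : {fsfun seq I -> R[i] with 0}, (forall w, w \in finsupp p -> Sigma w) ->
    poly_sum M p = mu (poly_sum (fun w => \prod_(i <- w) cstarS i) p) (M [::])) ->
  kernel_le (K3 Sigma M) (K4 Sigma M).
Proof.
move=> Sigma_adm [mu1 mu_cp mu_mul] muM h.
have muE w : Sigma w -> mu (Sword w) (M [::]) = M w.
  move=> Sw; have := muM [fsfun [fsfun] with w |-> 1]; rewrite /poly_sum.
  have fw : finsupp ([fsfun [fsfun] with w |-> 1] : {fsfun seq I -> R[i] with 0}) = [fset w]%fset.
    by rewrite finsupp_with oner_eq0 finsupp0 fsetU0.
  rewrite fw !big_seq_fset1 fsfun_withE eqxx !scale1r => -> // v.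
  by rewrite inE => /eqP ->.
(* Admissibility puts w in [Sigma], so M(w) is mu(S_w) at [M [::]], and multiplicativity applies to
   S_v S_w. *)
have mu_cat v w : Sigma (v ++ w) -> mu (Sword v) (M w) = M (v ++ w).
  move=> Svw; rewrite -muE; last exact: Sigma_adm Svw.
  rewrite -(muE _ Svw) Sword_cat mu_mul //; first exact: disc_algebra_word.
  exact: disc_disc_star_word.
pose x i := tnth (in_tuple (finsupp h)) i.
pose a i := (val (x i)).1; pose b i := (val (x i)).2.
have Sx i : Sigma (a i ++ b i) by exact: set_valP (x i).
have := cp_schwarz mu1 mu_cp (fun i => h (x i) *: M (b i)) (fun i => adjoint_word (a i)).
have tnthE (F : Lambda Sigma -> Lambda Sigma -> R[i]) :
    \sum_(y <- finsupp h) \sum_(z <- finsupp h) F y z = \sum_i \sum_j F (x i) (x j).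
  by rewrite big_tnth; apply: eq_bigr => i _; rewrite big_tnth.
have linZ (X : cstar R I) j : mu X (h (x j) *: M (b j)) = h (x j) *: mu X (M (b j)).
  exact: linearZ.
have K3E : `|\sum_j mu (Sword (a j)) (h (x j) *: M (b j))| ^+ 2 =
    \sum_i \sum_j K3 Sigma M (x i) (x j) * h (x j) * (h (x i))^*.
  rewrite -inner_norm inner_sumr; apply: eq_bigr => i _.
  rewrite inner_suml; apply: eq_bigr => j _.
  rewrite !linZ !mu_cat // innerZl innerZr /K3 /a /b.
  by case: (val (x i)) => ? ?; case: (val (x j)) => ? ? /=; ring.
have K4E : \sum_i \sum_j inner (mu (Bword (a i) * Sword (a j)) (h (x j) *: M (b j)))
      (h (x i) *: M (b i)) =
    \sum_i \sum_j K4 Sigma M (x i) (x j) * h (x j) * (h (x i))^*.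
  apply: eq_bigr => i _; apply: eq_bigr => j _.
  rewrite linZ innerZl innerZr mulrCA mulrC [h (x j) * _]mulrC.
  congr (_ * _ * _).
  have := Sx i; have := Sx j; rewrite BwordSword /K4 /a /b /word_quot.
  case: (val (x i)) => a1 b1; case: (val (x j)) => a2 b2 /= S2 S1.
  (* If a2 = a1 t, admissibility puts t b2 in [Sigma], so that mu(S_t) sends M(b2) to M(t b2). *)
  case: ifP => [/prefixP[t ta]|_].
    rewrite ta drop_size_cat // in S2 *; rewrite mu_cat //.
    by apply: (Sigma_adm a1); rewrite catA.
  case: ifP => [/andP[/prefixP[t ta] _]|_]; last by rewrite raddf0 bop0E inner0l.
  (* If a1 = a2 t, the image of the adjoint of S_t is moved to the other side, where mu(S_t) acts on
     M(b1). *)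
  rewrite ta drop_size_cat // in S1 *.
  rewrite (cp_adjoint mu1 mu_cp _ _ (adjoint_word t)) mu_cat //.
  by apply: (Sigma_adm a2); rewrite catA.
rewrite K3E K4E -subr_ge0 tnthE => K34; apply: le_trans K34 _.
rewrite le_eqVlt; apply/orP; left; apply/eqP.
rewrite -sumrB; apply: eq_bigr => i _; rewrite -sumrB; apply: eq_bigr => j _.
by rewrite !mulrBl.
Qed.

Theorem theorem2p3 (R : realType) (n : option nat) (n_gt0 : n <> Some 0%N)
    (H : hilbertType R) (Sigma : set (seq (gen n))) (Sigma_adm : admissible Sigma)
    (M : seq (gen n) -> H) :
  (exists2 mu : {linear cstar R (gen n) -> bounded_op H}, poisson_transform mu &
    forall p : {fsfun seq (gen n) -> R[i] with 0},
      (forall w, w \in finsupp p -> Sigma w) ->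
      poly_sum M p =
      mu (poly_sum (fun w => \prod_(i <- w) cstarS i) p) (M [::]))
  <-> kernel_le (K3 Sigma M) (K4 Sigma M).
Proof.
split; last exact: transform_of_kernel_le.
by move=> [mu mu_poisson muM]; exact: kernel_le_of_transform muM.
Qed.
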